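(* Let $n\ge 1$ and let $u\le w$ in the Bruhat order on $\Sigma_n$. Then \[ \mathfrak{S}_{w/u}(x)\ =\ \sum_{v\in\Sigma_n} c^w_{u,v}\,\mathfrak{S}_{w_0v}(x)\,. \]
   Context: $\Sigma_n$ is the symmetric group on $\{1,\dots,n\}$, $w_0=n\,(n-1)\cdots 2\,1$ is its longest element, and $\mathfrak{S}_w(x)$ denotes the (Lascoux–Schützenberger) Schubert polynomial of $w$. For $u,v,w\in\Sigma_n$, $c^w_{u,v}$ is the coefficient of $\mathfrak{S}_w(x)$ in the expansion $\mathfrak{S}_u(x)\mathfrak{S}_v(x)=\sum_w c^w_{u,v}\mathfrak{S}_w(x)$. The cohomology ring of the flag manifold is $H^*\mathrm{F}\ell_n=\mathbb{Z}[x_1,\dots,x_n]/\langle e_1,\dots,e_n\rangle$ ($e_i$ the elementary symmetric polynomials in $x_1,\dots,x_n$), and $\sigma_w$ is the class of $\mathfrak{S}_w(x)$ (the Schubert class). Using the degree reverse lexicographic term order with $x_1<x_2<\dots<x_n$, every element of $H^*\mathrm{F}\ell_n$ has a unique normal form polynomial representative. The skew Schubert polynomial $\mathfrak{S}_{w/u}(x)$ is defined as the normal form representative of the class $\sigma_u\cdot\sigma_{w_0w}$. (Schubert polynomials $\mathfrak{S}_w$, $w\in\Sigma_n$, are themselves normal form representatives of $\sigma_w$.) *)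

(* Defs.v *)
From HB Require Import structures.
From mathcomp Require Import all_boot all_order all_algebra all_fingroup.
From mathcomp Require Import boolp classical_sets.
From mathcomp Require Import mpoly.

Set Implicit Arguments.
Unset Strict Implicit.
Unset Printing Implicit Defensive.

Import GRing.Theory.
Local Open Scope ring_scope.

(** Throughout, Sigma_n is ['S_n] and indices are shifted by one: the variable
    x_(k+1) is ['X_k], and permutations act on [{0, ..., n-1}].
    MathComp composes permutations from left to right: [(s * t)%g x = t (s x)],
    so the function composite [w o t] is [(t * w)%g]. *)

Definition perm_length n (w : 'S_n) : nat :=
  #|[set p : 'I_n * 'I_n | (p.1 < p.2)%N && (w p.2 < w p.1)%N]|.

(** [v = u o (a b)] for a transposition (a b), with larger length. *)
Definition bruhat_step n (u v : 'S_n) : bool :=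
  [exists a : 'I_n, exists b : 'I_n,
     (v == (tperm a b * u)%g) && (perm_length u < perm_length v)%N].

Definition bruhat_le n (u w : 'S_n) : bool := connect (@bruhat_step n) u w.

Definition longest n : 'S_n := perm (@rev_ord_inj n).

(** The permutation usually written w_0 w, that is, [i |-> w_0 (w i)]. *)
Definition w0mul n (w : 'S_n) : 'S_n := (w * longest n)%g.

Section Schubert.
Variable n : nat.
Local Notation P := {mpoly int[n]}.

(** The quotient (f - s f) / (x_i - x_j), where s exchanges x_i and x_j. *)
Definition divdiff (i j : 'I_n) (f : P) : P :=
  xget 0 [set q : P | q * ('X_i - 'X_j) = f - msym (tperm i j) f]%classic.

(** x_1^(n-1) x_2^(n-2) ... x_(n-1) *)
Definition staircase : P := 'X_[ [multinom (n - i.+1)%N | i < n] ].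

(** Descending recursion S_w = d_i S_(w s_i) at an ascent w(i) < w(i+1); the
    result does not depend on the ascents picked, by the braid relations.
    [k] is the codimension l(w_0) - l(w) of [w]. *)
Fixpoint schubert_rec (k : nat) (w : 'S_n) : P :=
  if k is k'.+1 then
    if [pick p : 'I_n * 'I_n | (p.2 == p.1.+1 :> nat) && (w p.1 < w p.2)%N]
       is Some p
    then divdiff p.1 p.2 (schubert_rec k' (tperm p.1 p.2 * w)%g)
    else staircase
  else staircase.

Definition schubert (w : 'S_n) : P :=
  schubert_rec (perm_length (longest n) - perm_length w) w.

End Schubert.

Section StableEmbedding.
Variables n k : nat.

Definition stable_fun (s : 'S_n) (i : 'I_(n + k)) : 'I_(n + k) :=
  match split i with
  | inl j => lshift k (s j)
  | inr j => rshift n j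
  end.

Lemma stable_fun_inj (s : 'S_n) : injective (stable_fun s).
Proof.
move=> i j; rewrite /stable_fun.
case: (split_ordP i) => i' ->; case: (split_ordP j) => j' -> /eqP.
- by rewrite eq_lshift => /eqP /perm_inj ->.
- by rewrite eq_lrshift.
- by rewrite eq_rlshift.
- by move=> /eqP.
Qed.

(** The inclusion of Sigma_n in Sigma_(n+k). *)
Definition stable_perm (s : 'S_n) : 'S_(n + k) := perm (@stable_fun_inj s).

End StableEmbedding.

(** The coefficient c^w_(u,v) of S_w in S_u S_v. The expansion of S_u S_v as a
    polynomial may involve permutations outside Sigma_n (for instance
    S_21 S_21 = x_1^2 = S_312), so it is taken in some Sigma_(n+k). *)
Definition structure_coef n (u v w : 'S_n) : int :=
  xget 0 [set z : int | exists k (c : 'S_(n + k) -> int),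
    schubert (stable_perm k u) * schubert (stable_perm k v)
      = \sum_(t : 'S_(n + k)) c t *: schubert t
    /\ z = c (stable_perm k w)]%classic.

(** The ideal <e_1, ..., e_n> of Z[x_1, ..., x_n]. *)
Definition flag_ideal n : {pred {mpoly int[n]}} := fun f =>
  `[< exists g : 'I_n -> {mpoly int[n]},
        f = \sum_(i < n) g i * mesym n int i.+1 >].

Lemma mesymS_at0 n k : (mesym n int k.+1).@[fun=> 0] = 0.
Proof.
rewrite /mesym raddf_sum /= big1 // => h /eqP hk.
have /card_gt0P [i ih] : (0 < #|h|)%N by rewrite hk.
by rewrite (bigD1 i) //= mevalM mevalXU mul0r.
Qed.

Lemma flag_ideal_closed n : idealr_closed (@flag_ideal n).
Proof.
split.
- by apply/asboolP; exists (fun=> 0); rewrite big1 // => i _; rewrite mul0r.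
- apply/negP => /asboolP [g /(congr1 (meval (fun=> 0)))].
  rewrite meval1 raddf_sum big1 => [/eqP|i _]; first by rewrite oner_eq0.
  by rewrite /= mevalM mesymS_at0 mulr0.
- move=> a f h /asboolP [p ->] /asboolP [q ->]; apply/asboolP.
  exists (fun i => a * p i + q i).
  rewrite mulr_sumr -big_split; apply: eq_bigr => i _ /=.
  by rewrite mulrDl mulrA.
Qed.

HB.instance Definition _ n :=
  isIdealr.Build {mpoly int[n]} (@flag_ideal n) (@flag_ideal_closed n).

(** H^*(Fl_n) *)
Notation flag_cohomology n := {ideal_quot (@flag_ideal n)}.

Definition flag_class n (f : {mpoly int[n]}) : flag_cohomology n :=
  (\pi_(flag_cohomology n) f)%qT.

Definition schubert_class n (w : 'S_n) : flag_cohomology n :=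
  flag_class (schubert w).

(** Degree reverse lexicographic order with x_1 < x_2 < ... < x_n: in equal
    degree, compare exponents at the first (that is, smallest) variable where
    they differ; the larger exponent there gives the smaller monomial. *)
Definition drl_lt n (m1 m2 : 'X_{1..n}) : bool :=
  (mdeg m1 < mdeg m2)%N ||
  ((mdeg m1 == mdeg m2) &&
   [exists i : 'I_n, (m2 i < m1 i)%N &&
      [forall j : 'I_n, (j < i)%N ==> (m1 j == m2 j)]]).

Definition is_drl_lead n (f : {mpoly int[n]}) (m : 'X_{1..n}) : Prop :=
  m \in msupp f /\ forall m', m' \in msupp f -> m' != m -> drl_lt m' m.

(** No monomial of [p] is divisible by the leading monomial of an element of
    the ideal. *)
Definition is_normal_form n (p : {mpoly int[n]}) : Prop :=
  forall (f : {mpoly int[n]}) (m m' : 'X_{1..n}),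
    f \in @flag_ideal n -> is_drl_lead f m -> m' \in msupp p ->
    ~ (forall i, (m i <= m' i)%N).

Definition normal_form n (h : flag_cohomology n) : {mpoly int[n]} :=
  xget 0 [set p | is_normal_form p /\ flag_class p = h]%classic.

Definition skew_schubert n (w u : 'S_n) : {mpoly int[n]} :=
  normal_form (schubert_class u * schubert_class (w0mul w)).

(* Main.v *)
(** Both sides are normal forms, so it suffices to compare their classes. A
    polynomial supported on the staircase monomials (the exponent of x_i is at
    most n - i) is a normal form: modulo the ideal, the complete symmetric
    polynomial of degree n - i + 1 in x_1, ..., x_i vanishes, which rewrites any
    monomial in terms of smaller staircase ones, and no nonzero staircase polynomial
    lies in the ideal. The latter, and the fact that the Schubert polynomials are
    a basis of the staircase polynomials, follow by counting from the functionals
    f |-> (d_w f)(0), which vanish on the ideal and are dual to the Schubert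
    polynomials. The coefficient c^w_(u,v) is (d_w (S_u S_v))(0). As d_i is
    self-adjoint for the pairing (d_(w_0) (f g))(0), the polynomials S_w and
    S_(w_0 w) are dual bases, hence c^w_(u,v) is the value of the top coefficient
    on S_u S_v S_(w_0 w), which is also the coefficient of S_(w_0 v) in the
    class of S_u S_(w_0 w). *)

Require Import Defs.
From mathcomp Require Import all_boot all_order all_algebra all_fingroup.
From mathcomp Require Import boolp classical_sets.
From mathcomp Require Import mpoly.
From mathcomp Require Import zify ring.

Set Implicit Arguments.
Unset Strict Implicit.
Unset Printing Implicit Defensive.

Import Order.TTheory GRing.Theory.
Local Open Scope ring_scope.

(** * Adjacent transpositions and length *)

(** Exchanging the two positions carries the inversions of [w] bijectively to those of the product;
    the only new one is [(a, b)] itself. *)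
Lemma perm_length_swap n (w : 'S_n) (a b : 'I_n) :
  b = a.+1 :> nat -> (w a < w b)%N ->
  perm_length (tperm a b * w)%g = (perm_length w).+1.
Proof.
move=> hab hw; rewrite /perm_length.
set A := [set p | _] ; set B := [set p | _].
pose f (p : 'I_n * 'I_n) := (tperm a b p.1, tperm a b p.2).
have fK : involutive f by case=> i j; rewrite /f /= !tpermK.
suff -> : A = (a, b) |: [set f p | p in B].
  rewrite cardsU1 card_imset; last exact: inv_inj.
  rewrite -[(a, b)]fK mem_imset; last exact: inv_inj.
  by rewrite inE /f /= tpermL tpermR ltnNge hab leqnSn.
apply/setP => -[i j].
rewrite !inE -[X in X \in _ @: _]fK mem_imset; last exact: inv_inj.
rewrite inE /= !permM xpair_eqE.
have Hi := ltn_ord i; have Hj := ltn_ord j.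
case: (tpermP a b i) => [->|->|/eqP + /eqP]; rewrite -?val_eqE;
case: (tpermP a b j) => [->|->|/eqP + /eqP]; rewrite -?val_eqE /=;
  move: hw hab; rewrite ?ltnn ?eqxx ?andbF ?andbT ?orbF //=; lia.
Qed.

Lemma longestE n (i : 'I_n) : longest n i = rev_ord i.
Proof. by rewrite permE. Qed.

Lemma w0mulE n (w : 'S_n) i : w0mul w i = rev_ord (w i).
Proof. by rewrite permM longestE. Qed.

(** Without ascents [w k + k] is weakly decreasing in [k]. It is at most [m] at 0 and at least [m]
    at the last index [m], hence constantly [m]. *)
Lemma no_ascent_longest n (w : 'S_n) :
  (forall a b : 'I_n, b = a.+1 :> nat -> ~~ (w a < w b)%N) -> w = longest n.
Proof.
case: n w => [|m] w hw; first by apply/permP; case.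
pose g k : nat := (w (inord k) + k)%N.
have gS k : (k < m)%N -> (g k.+1 <= g k)%N.
  move=> km; have := hw (inord k) (inord k.+1).
  rewrite !inordK; [|lia|lia].
  move=> /(_ erefl); rewrite -leqNgt leq_eqVlt => /orP [|]; last by rewrite /g; lia.
  move=> /eqP /val_inj /perm_inj /(congr1 val); rewrite /= !inordK; lia.
have g_hi k : (k <= m)%N -> (g k <= m)%N.
  elim: k => [_|k IH km]; last by apply: leq_trans (gS _ km) (IH _); lia.
  by rewrite /g addn0 -ltnS ltn_ord.
have g_lo k : (k <= m)%N -> (m <= g (m - k))%N.
  elim: k => [_|k IH km]; first by rewrite subn0 /g leq_addl.
  have km' : (m - k.+1 < m)%N by lia.
  apply: leq_trans (IH _) _; first by lia.
  by rewrite (_ : m - k = (m - k.+1).+1)%N; [exact: gS | lia].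
apply/permP => i; apply: val_inj; rewrite longestE /=.
have im : (i <= m)%N by rewrite -ltnS.
have := g_hi i im; have := g_lo (m - i)%N (leq_subr _ _).
by rewrite subKn // /g inord_val; lia.
Qed.

Lemma longest_or_ascent n (w : 'S_n) :
  w = longest n \/ exists a b : 'I_n, b = a.+1 :> nat /\ (w a < w b)%N.
Proof.
have [/existsP [a /existsP [b /andP [/eqP ? ?]]]|H] :=
  boolP [exists a : 'I_n, exists b : 'I_n, (b == a.+1 :> nat) && (w a < w b)%N].
  by right; exists a, b.
left; apply: no_ascent_longest => a b hab; apply: contra H => hw.
by apply/existsP; exists a; apply/existsP; exists b; rewrite hab eqxx.
Qed.

Lemma w0mul_mul n (s w : 'S_n) : w0mul (s * w)%g = (s * w0mul w)%g.
Proof. by rewrite /w0mul mulgA. Qed.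

Lemma longest_mul n : (longest n * longest n)%g = 1%g.
Proof. by apply/permP => i; rewrite permM !longestE rev_ordK perm1. Qed.

Lemma w0mulK n : involutive (@w0mul n).
Proof. by move=> w; rewrite /w0mul -mulgA longest_mul mulg1. Qed.

Lemma w0mul_lt n (w : 'S_n) a b : (w0mul w a < w0mul w b)%N = (w b < w a)%N.
Proof. by rewrite !w0mulE /=; have := ltn_ord (w a); have := ltn_ord (w b); lia. Qed.

Lemma id_or_descent n (w : 'S_n) :
  w = 1%g \/ exists a b : 'I_n, b = a.+1 :> nat /\ (w b < w a)%N.
Proof.
case: (longest_or_ascent (w0mul w)) => [h|[a [b [hab]]]].
  by left; rewrite -[w]w0mulK h /w0mul longest_mul.
by rewrite w0mul_lt => h; right; exists a, b.
Qed.

Lemma perm_length1 n : perm_length (1%g : 'S_n) = 0%N.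
Proof.
apply/eqP; rewrite cards_eq0; apply/eqP/setP => p.
by rewrite !inE !perm1; case: ltngtP.
Qed.

Lemma perm_length_unswap n (w : 'S_n) (a b : 'I_n) :
  b = a.+1 :> nat -> (w b < w a)%N ->
  perm_length w = (perm_length (tperm a b * w)%g).+1.
Proof.
move=> hab hw; rewrite -(perm_length_swap hab); last by rewrite !permM tpermL tpermR.
by rewrite mulgA tperm2 mul1g.
Qed.

Lemma perm_length_eq0 n (w : 'S_n) : perm_length w = 0%N -> w = 1%g.
Proof.
by case: (id_or_descent w) => // -[a [b [hab /(perm_length_unswap hab) ->]]].
Qed.

Lemma perm_length_max n (w : 'S_n) : (perm_length w <= perm_length (longest n))%N.
Proof.
apply/subset_leq_card/fintype.subsetP => p; rewrite !inE => /andP [h _].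
move: h; rewrite /= !longestE /=; have := ltn_ord p.2; case: p => i j /= *; apply/andP; split; lia.
Qed.

(** The sum is the degree of the staircase monomial, the starting point for homogeneity of Schubert
    polynomials. *)
Lemma perm_length_longest n : perm_length (longest n) = (\sum_(i < n) (n - i.+1))%N.
Proof.
rewrite /perm_length -sum1dep_card.
rewrite (eq_bigl (fun p : 'I_n * 'I_n => true && (p.1 < p.2)%N)); last first.
  by case=> i j; rewrite /= !longestE /=; have := ltn_ord j; lia.
rewrite -(pair_big_dep xpredT (fun i j : 'I_n => (i < j)%N) (fun _ _ => 1%N)) /=.
apply: eq_bigr => i _; rewrite sum1_card -[RHS](card_ord (n - i.+1)).
have hlt (k : 'I_(n - i.+1)) : (i.+1 + k < n)%N by have := ltn_ord k; lia.
have inj : injective (fun k => Ordinal (hlt k)).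
  by move=> k l /(congr1 val) /=; move/addnI => h; apply: val_inj.
rewrite -(card_imset _ inj); apply: eq_card => j.
rewrite [LHS]unfold_in; apply/idP/imsetP => [h|[k _ ->] /=]; last by lia.
have hk : (j - i.+1 < n - i.+1)%N by have := ltn_ord j; lia.
by exists (Ordinal hk) => //; apply: val_inj => /=; lia.
Qed.

Lemma tperm_swapE n (w : 'S_n) (a b x : 'I_n) :
  (tperm a b * w)%g x = if x == a then w b else if x == b then w a else w x.
Proof. by rewrite permM; case: tpermP => [->|->|/eqP/negbTE -> /eqP/negbTE ->];
  rewrite ?eqxx //; case: eqP => // ->. Qed.

(** Each side is a transposition conjugated by another one, and both equal [tperm a c]. *)
Lemma tperm_braid n (a b c : 'I_n) : a != b -> b != c -> a != c ->
  (tperm a b * (tperm b c * tperm a b))%g = (tperm b c * (tperm a b * tperm b c))%g.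
Proof.
move=> ab bc ac.
have E (s t : 'S_n) : (s^-1 = s)%g -> (s * (t * s))%g = (t ^ s)%g.
  by move=> h; rewrite conjgE h.
by rewrite !E ?tpermV // !tpermJ !(tpermL, tpermR) !tpermD // 1?eq_sym.
Qed.

Lemma tperm_comm n (a b c d : 'I_n) : a != c -> a != d -> b != c -> b != d ->
  (tperm a b * tperm c d)%g = (tperm c d * tperm a b)%g.
Proof.
move=> ac ad bc bd.
by rewrite [RHS]conjgC tpermJ !tpermD // eq_sym.
Qed.

(** * Divided differences *)

Definition supported n (P : 'X_{1..n} -> Prop) (f : {mpoly int[n]}) :=
  forall m, m \in msupp f -> P m.

Lemma supported_sum n (P : 'X_{1..n} -> Prop) (I : Type) (r : seq I) (Q : pred I)
    (F : I -> {mpoly int[n]}) :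
  (forall i, Q i -> supported P (F i)) -> supported P (\sum_(i <- r | Q i) F i).
Proof.
move=> h; elim/big_ind: _ => // [m|f g hf hg m]; first by rewrite msupp0.
by move=> /msuppD_le; rewrite mem_cat => /orP [/hf|/hg].
Qed.

Lemma supported_sum_seq n (P : 'X_{1..n} -> Prop) (I : eqType) (r : seq I)
    (F : I -> {mpoly int[n]}) :
  (forall i, i \in r -> supported P (F i)) -> supported P (\sum_(i <- r) F i).
Proof. by move=> h; rewrite big_seq; apply: supported_sum. Qed.

Lemma supportedD n (P : 'X_{1..n} -> Prop) (f g : {mpoly int[n]}) :
  supported P f -> supported P g -> supported P (f + g).
Proof. by move=> hf hg m /msuppD_le; rewrite mem_cat => /orP [/hf|/hg]. Qed.

Lemma supportedN n (P : 'X_{1..n} -> Prop) (f : {mpoly int[n]}) :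
  supported P f -> supported P (- f).
Proof. by move=> hf m; rewrite (perm_mem (msuppN f)) => /hf. Qed.

Lemma supportedZ n (P : 'X_{1..n} -> Prop) c (f : {mpoly int[n]}) :
  supported P f -> supported P (c *: f).
Proof. by move=> hf m /msuppZ_le /hf. Qed.

Lemma supportedX n (P : 'X_{1..n} -> Prop) m : P m -> supported P 'X_[m].
Proof. by move=> hm m' /mem_msuppXP <-. Qed.

Lemma supportedM n (P Q S : 'X_{1..n} -> Prop) (f g : {mpoly int[n]}) :
  supported P f -> supported Q g ->
  (forall m m', P m -> Q m' -> S (m + m')%MM) -> supported S (f * g).
Proof.
by move=> hf hg h m /msuppM_le /allpairsP [[x y] /= [/hf ? /hg ? ->]]; apply: h.
Qed.

(** After extracting [(x y)^d] this is the geometric sum for [x^k - y^k]; it gives the divided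
    difference of a monomial explicitly. *)
Lemma geometric_divdiff (R : comNzRingType) (u x y : R) d k :
  \sum_(i < k) u * x ^+ (d + (k.-1 - i)) * y ^+ (d + i) * (x - y) =
  u * x ^+ (k + d) * y ^+ d - u * x ^+ d * y ^+ (k + d).
Proof.
transitivity (u * (x ^+ d * y ^+ d) *
    ((x - y) * \sum_(i < k) x ^+ (k.-1 - i) * y ^+ i)).
  by rewrite !mulr_sumr; apply: eq_bigr => i _; rewrite !exprD; ring.
by rewrite -subrXX !exprD; ring.
Qed.

Section DivDiff.
Variables (n : nat) (a b : 'I_n).
Hypothesis hab : a != b.
Local Notation P := {mpoly int[n]}.
Local Notation s := (tperm a b).

Let upd (m : 'X_{1..n}) c d : 'X_{1..n} :=
  [multinom if i == a then c else if i == b then d else m i | i < n].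

Let updE m c d : 'X_[upd m c d] = 'X_[upd m 0 0] * 'X_a ^+ c * 'X_b ^+ d :> P.
Proof.
rewrite !mpolyXn -!mpolyXD; congr mpolyX; apply/mnmP => i.
rewrite !mnmDE !mnmE !mulmnE !mnm1E.
have hba : b != a by rewrite eq_sym.
case: (eqVneq i a) => [->|_]; first by rewrite ?(negbTE hba); lia.
by case: (eqVneq i b) => _; lia.
Qed.

Let msym_monE m : msym s 'X_[m] = 'X_[upd m (m b) (m a)] :> P.
Proof.
rewrite msymX tpermV; congr mpolyX; apply/mnmP => i; rewrite !mnmE.
by case: tpermP => [->|->|/eqP/negbTE -> /eqP/negbTE ->]; rewrite ?eqxx // eq_sym (negbTE hab).
Qed.

Let upd_id m : upd m (m a) (m b) = m.
Proof. by apply/mnmP => i; rewrite mnmE; do 2?case: eqP => [->|_]. Qed.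

(** Describes the monomials occurring in the divided difference of ['X_[m]]: the drop in degree
    serves homogeneity, the strict bounds serve the staircase. *)
Definition divdiff_mon_rel (m m' : 'X_{1..n}) : Prop :=
  [/\ (mdeg m').+1 = mdeg m, (m' a < maxn (m a) (m b))%N,
      (m' b < maxn (m a) (m b))%N
    & forall i, i != a -> i != b -> m' i = m i].

Let mdeg_upd m c d : mdeg (upd m c d) = (mdeg (upd m 0 0) + c + d)%N.
Proof.
have /(congr1 (fun p : P => msize p)) := updE m c d.
rewrite !mpolyXn -!mpolyXD !msizeX !mdegD !mdegMn !mdeg1 => -[].
by rewrite !mul1n.
Qed.

Let divdiff_upd m c d : (d <= c)%N -> exists2 g : P,
  g * ('X_a - 'X_b) = 'X_[upd m c d] - 'X_[upd m d c] &
  supported (fun m' => [/\ (mdeg m').+1 = (mdeg (upd m 0 0) + c + d)%N,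
     (m' a < c)%N, (m' b < c)%N & forall i, i != a -> i != b -> m' i = m i]) g.
Proof.
move=> dc; exists (\sum_(i < c - d) 'X_[upd m (d + ((c - d).-1 - i)) (d + i)]).
  rewrite mulr_suml; under eq_bigr do rewrite updE.
  by rewrite geometric_divdiff (subnK dc) -!updE.
apply: supported_sum => i _; apply: supportedX; have := ltn_ord i.
rewrite mdeg_upd !mnmE !eqxx (eq_sym b a) (negbTE hab) => hi; split; try lia.
by move=> j /negbTE ja /negbTE jb; rewrite mnmE ja jb.
Qed.

Lemma divdiff_mon_ex m : exists2 g : P,
  g * ('X_a - 'X_b) = 'X_[m] - msym s 'X_[m] & supported (divdiff_mon_rel m) g.
Proof.
have Em : mdeg m = (mdeg (upd m 0 0) + m a + m b)%N by rewrite -{1}(upd_id m) mdeg_upd.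
rewrite msym_monE -{1}(upd_id m); case: (leqP (m b) (m a)) => hm.
  have [g hg sg] := divdiff_upd m hm; exists g => // m' /sg [h1 h2 h3 h4].
  by split => //; [rewrite Em | rewrite leq_max h2 | rewrite leq_max h3].
have [g hg sg] := divdiff_upd m (ltnW hm); exists (- g).
  by rewrite mulNr hg opprB.
apply: supportedN => m' /sg [h1 h2 h3 h4].
by split => //; [rewrite Em -addnA [(m a + _)%N]addnC addnA
  | rewrite leq_max h2 orbT | rewrite leq_max h3 orbT].
Qed.

Lemma subX_neq0 : 'X_a - 'X_b != 0 :> P.
Proof.
apply/eqP => /(congr1 (mcoeff U_(a)%MM)) /eqP.
by rewrite mcoeffB !mcoeffXU eqxx (eq_sym b) (negbTE hab) mcoeff0.
Qed.

(** The quotient is assembled monomial by monomial, so that support bounds come with it;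
    [divdiff_uniq] transfers them to [divdiff]. *)
Lemma divdiff_ex f : exists2 g : P, g * ('X_a - 'X_b) = f - msym s f &
  forall Q R : 'X_{1..n} -> Prop, supported Q f ->
   (forall m m', Q m -> divdiff_mon_rel m m' -> R m') -> supported R g.
Proof.
pose d m := projT1 (cid2 (divdiff_mon_ex m)).
have dP m : d m * ('X_a - 'X_b) = 'X_[m] - msym s 'X_[m].
  by rewrite /d; case: cid2.
have dS m : supported (divdiff_mon_rel m) (d m) by rewrite /d; case: cid2.
exists (\sum_(m <- msupp f) f@_m *: d m).
  have -> : f - msym s f = \sum_(m <- msupp f) (f@_m *: 'X_[m] - msym s (f@_m *: 'X_[m])).
    by rewrite sumrB -raddf_sum -mpolyE.
  rewrite mulr_suml; apply: eq_bigr => m _.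
  by rewrite /= -scalerAl dP msymZ scalerBr.
move=> Q R hQ QR; apply: supported_sum_seq => m hm; apply: supportedZ.
by move=> m' /dS; apply: QR; apply: hQ.
Qed.

Lemma divdiffP f : divdiff a b f * ('X_a - 'X_b) = f - msym s f.
Proof.
by have [g hg _] := divdiff_ex f; rewrite /divdiff; case: xgetP => // /(_ g).
Qed.

Lemma divdiff_uniq f g : g * ('X_a - 'X_b) = f - msym s f -> divdiff a b f = g.
Proof. by move=> h; apply: (mulIf subX_neq0); rewrite divdiffP h. Qed.

Lemma divdiff_supported (Q R : 'X_{1..n} -> Prop) f : supported Q f ->
  (forall m m', Q m -> divdiff_mon_rel m m' -> R m') -> supported R (divdiff a b f).
Proof.
by have [g hg h] := divdiff_ex f; rewrite (divdiff_uniq hg); apply: h.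
Qed.

Lemma divdiffD f g : divdiff a b (f + g) = divdiff a b f + divdiff a b g.
Proof. by apply: divdiff_uniq; rewrite mulrDl !divdiffP msymD; ring. Qed.

Lemma divdiffZ c f : divdiff a b (c *: f) = c *: divdiff a b f.
Proof. by apply: divdiff_uniq; rewrite -scalerAl divdiffP msymZ scalerBr. Qed.

Lemma divdiff_eq0 f : msym s f = f -> divdiff a b f = 0.
Proof. by move=> h; apply: divdiff_uniq; rewrite h subrr mul0r. Qed.

Lemma divdiff0 : divdiff a b 0 = 0.
Proof. by apply: divdiff_eq0; rewrite msym0. Qed.

Lemma divdiff_sum (I : Type) (r : seq I) (Q : pred I) (F : I -> P) :
  divdiff a b (\sum_(i <- r | Q i) F i) = \sum_(i <- r | Q i) divdiff a b (F i).
Proof. by apply: (big_morph (divdiff a b) divdiffD divdiff0). Qed.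

Lemma msymXi (t : 'S_n) i : msym t 'X_i = 'X_(t i) :> P.
Proof. by rewrite /msym mmapX mmap1U. Qed.

Lemma msym_tpermK : involutive (msym s : P -> P).
Proof. by move=> f; rewrite -msymMm tperm2 msym1m. Qed.

Lemma msym_divdiff f : msym s (divdiff a b f) = divdiff a b f.
Proof.
apply: (mulIf subX_neq0); rewrite divdiffP.
have -> : 'X_a - 'X_b = - msym s ('X_a - 'X_b) :> P.
  by rewrite msymB !msymXi tpermL tpermR opprB.
by rewrite mulrN -msymM divdiffP msymB msym_tpermK opprB.
Qed.

Lemma divdiff_divdiff f : divdiff a b (divdiff a b f) = 0.
Proof. by rewrite divdiff_eq0 // msym_divdiff. Qed.

Lemma divdiffM f g :
  divdiff a b (f * g) = divdiff a b f * g + msym s f * divdiff a b g.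
Proof.
by apply: divdiff_uniq; rewrite mulrDl mulrAC divdiffP -mulrA divdiffP msymM; ring.
Qed.

(** Linearity over invariants: it makes the flag ideal stable and yields self-adjointness of divided
    differences. *)
Lemma divdiffM_sym f g : msym s g = g -> divdiff a b (f * g) = divdiff a b f * g.
Proof. by move=> h; rewrite divdiffM (divdiff_eq0 h) mulr0 addr0. Qed.

End DivDiff.

(** Here [sf], [tf], [tsf] stand for the permuted copies of [f]; both sides equal
    [f - sf - tf + tsf]. *)
Lemma divdiff_comm_aux (R : comNzRingType) (h x y g tg g' sg' f sf tf tsf : R) :
  h * y = g - tg -> g * x = f - sf -> tg * x = tf - tsf ->
  g' * y = f - tf -> sg' * y = sf - tsf -> h * x * y = (g' - sg') * y.
Proof. by move=> E1 E2 E3 E4 E5; rewrite mulrAC E1 !mulrBl E2 E3 E4 E5; ring. Qed.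

Lemma divdiff_comm n (a b c d : 'I_n) (f : {mpoly int[n]}) :
  a != b -> c != d -> a != c -> a != d -> b != c -> b != d ->
  divdiff a b (divdiff c d f) = divdiff c d (divdiff a b f).
Proof.
move=> ab cd ac ad bc bd.
have sE g : msym (tperm a b) (msym (tperm c d) g) =
    msym (tperm c d) (msym (tperm a b) g) :> {mpoly int[n]}.
  by rewrite -(msymMm g (tperm c d)) -(msymMm g (tperm a b)) (tperm_comm ac ad bc bd).
have h1 : msym (tperm c d) ('X_a - 'X_b) = 'X_a - 'X_b :> {mpoly int[n]}.
  by rewrite msymB !msymXi !tpermD // eq_sym.
have h2 : msym (tperm a b) ('X_c - 'X_d) = 'X_c - 'X_d :> {mpoly int[n]}.
  by rewrite msymB !msymXi !tpermD // eq_sym.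
have E1 := divdiffP cd (divdiff a b f); have E2 := divdiffP ab f.
have E4 := divdiffP cd f.
have /(congr1 (msym (tperm c d))) := E2; rewrite msymM h1 msymB => E3.
have /(congr1 (msym (tperm a b))) := E4; rewrite msymM h2 msymB => E5.
rewrite sE in E5; apply: (divdiff_uniq ab); apply: (mulIf (subX_neq0 cd)).
exact: (divdiff_comm_aux E1 E2 E3 E4 E5).
Qed.

(* Multiplied by [x y (x + y)], both sides become the alternating sum of [f]
   over the six permutations of the three variables. *)
Lemma braid_idomain (R : idomainType) (s t : {rmorphism R -> R}) (x y : R)
    (d e : R -> R) :
  x != 0 -> y != 0 -> x + y != 0 -> s x = - x -> t y = - y ->
  s y = x + y -> t x = x + y -> involutive s -> involutive t ->
  (forall f, s (t (s f)) = t (s (t f))) ->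
  (forall f, d f * x = f - s f) -> (forall f, e f * y = f - t f) ->
  forall f, d (e (d f)) = e (d (e f)).
Proof.
move=> x0 y0 xy0 sx ty sy tx sK tK st dE eE f.
have sd g : s (d g) * x = g - s g.
  have := congr1 s (dE g); rewrite rmorphM rmorphB sx sK => h.
  by apply: oppr_inj; rewrite -mulrN h opprB.
have te g : t (e g) * y = g - t g.
  have := congr1 t (eE g); rewrite rmorphM rmorphB ty tK => h.
  by apply: oppr_inj; rewrite -mulrN h opprB.
have td g : t (d g) * (x + y) = t g - t (s g).
  by rewrite -tx -rmorphM dE rmorphB.
have se g : s (e g) * (x + y) = s g - s (t g).
  by rewrite -sy -rmorphM eE rmorphB.
have sxy : s (x + y) = y by rewrite rmorphD sx sy addKr.
have txy : t (x + y) = x by rewrite rmorphD ty tx addrK.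
have ste g : s (t (d g)) * y = s (t g) - s (t (s g)).
  by rewrite -sxy -rmorphM td rmorphB.
have tse g : t (s (e g)) * x = t (s g) - t (s (t g)).
  by rewrite -txy -rmorphM se rmorphB.
have z0 : x * y * (x + y) != 0 by rewrite !mulf_neq0.
apply: (mulIf z0).
have -> : d (e (d f)) * (x * y * (x + y)) =
    f - s f - (t f - t (s f)) + s (t f) - s (t (s f)) - 0.
  transitivity ((d (e (d f)) * x) * y * (x + y)); first by ring.
  rewrite dE.
  transitivity ((e (d f) * y) * (x + y) - s (e (d f)) * (x + y) * y); first by ring.
  rewrite eE se.
  transitivity (d f * x + d f * y - t (d f) * (x + y) - s (d f) * y + s (t (d f)) * y).
    by ring.
  rewrite td ste dE.
  have -> : s (d f) = d f by apply: (mulIf x0); rewrite sd dE.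
  by ring.
transitivity ((e (d (e f)) * y) * x * (x + y)); last by ring.
rewrite eE.
transitivity ((d (e f) * x) * (x + y) - t (d (e f)) * (x + y) * x); last by ring.
rewrite dE td.
transitivity (e f * y + e f * x - s (e f) * (x + y) - t (e f) * x + t (s (e f)) * x);
  last by ring.
rewrite se tse eE.
have -> : t (e f) = e f by apply: (mulIf y0); rewrite te eE.
by rewrite st; ring.
Qed.

Lemma msym3 n (s t u : 'S_n) (f : {mpoly int[n]}) :
  msym s (msym t (msym u f)) = msym (u * (t * s))%g f.
Proof. by rewrite (msymMm f u) (msymMm (msym u f) t). Qed.

Lemma divdiff_braid n (a b c : 'I_n) (f : {mpoly int[n]}) :
  a != b -> b != c -> a != c ->
  divdiff a b (divdiff b c (divdiff a b f)) =
  divdiff b c (divdiff a b (divdiff b c f)).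
Proof.
move=> ab bc ac.
have E : 'X_a - 'X_b + ('X_b - 'X_c) = 'X_a - 'X_c :> {mpoly int[n]} by ring.
apply: (@braid_idomain {mpoly int[n]} (msym (tperm a b)) (msym (tperm b c))
         ('X_a - 'X_b) ('X_b - 'X_c)) => [||||||||||g|g].
- exact: subX_neq0.
- exact: subX_neq0.
- by rewrite E subX_neq0.
- by rewrite /= msymB !msymXi tpermL tpermR opprB.
- by rewrite /= msymB !msymXi tpermL tpermR opprB.
- by rewrite E /= msymB !msymXi tpermR tpermD // eq_sym.
- by rewrite E /= msymB !msymXi tpermL tpermD // eq_sym.
- exact: msym_tpermK.
- exact: msym_tpermK.
- move=> g; change (msym (tperm a b) (msym (tperm b c) (msym (tperm a b) g)) =
    msym (tperm b c) (msym (tperm a b) (msym (tperm b c) g))).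
  apply: (etrans (msym3 _ _ _ _)); apply: (etrans _ (esym (msym3 _ _ _ _))).
  by rewrite (tperm_braid ab bc ac).
- exact: divdiffP.
- exact: divdiffP.
Qed.

(** * Independence of the chosen ascents *)

Lemma adj_neq n (a b : 'I_n) : b = a.+1 :> nat -> a != b.
Proof. by move=> h; rewrite -val_eqE /= h neq_ltn leqnn. Qed.

Lemma schubert_longest n : schubert (longest n) = staircase n.
Proof. by rewrite /schubert subnn. Qed.

Lemma schubert_some_ascent n (w : 'S_n) : w != longest n ->
  exists a b : 'I_n, [/\ b = a.+1 :> nat, (w a < w b)%N
    & schubert w = divdiff a b (schubert (tperm a b * w)%g)].
Proof.
move=> hw; case: (longest_or_ascent w) => [h|]; first by rewrite h eqxx in hw.
move=> [a0 [b0 [hab0 hw0]]].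
have hL (a b : 'I_n) : b = a.+1 :> nat -> (w a < w b)%N ->
    (perm_length (longest n) - perm_length w)%N =
    (perm_length (longest n) - perm_length (tperm a b * w)%g).+1.
  move=> hab hwab; have := perm_length_max (tperm a b * w)%g.
  by rewrite (perm_length_swap hab hwab); lia.
rewrite {1 2}/schubert (hL _ _ hab0 hw0) /=; case: pickP => [[a b] /= /andP [/eqP hab hwab]|].
  exists a, b; split; [exact: hab | exact: hwab |].
  by move: (hL _ _ hab0 hw0); rewrite (hL _ _ hab hwab) => -[] <-.
by move=> /(_ (a0, b0)); rewrite /= hab0 eqxx hw0.
Qed.

(** Diamond argument by induction on the codimension: the ascent picked by the recursion and the
    given one coincide, are disjoint, or share a position. Disjoint ones are joined by commutation,
    overlapping ones by the braid relation. *)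
Lemma schubert_ascent n (w : 'S_n) (a b : 'I_n) :
  b = a.+1 :> nat -> (w a < w b)%N ->
  schubert w = divdiff a b (schubert (tperm a b * w)%g).
Proof.
have [k] := ubnP (perm_length (longest n) - perm_length w)%N.
elim: k w a b => // k IH w a b hk hab hw.
(* [IH'] and [IH2] are the induction hypothesis one and two swaps above [w], where the codimension
   is smaller. *)
have IH' (a' b' : 'I_n) : b' = a'.+1 :> nat -> (w a' < w b')%N ->
    forall c d : 'I_n, d = c.+1 :> nat ->
    ((tperm a' b' * w)%g c < (tperm a' b' * w)%g d)%N ->
    schubert (tperm a' b' * w)%g =
      divdiff c d (schubert (tperm c d * (tperm a' b' * w))%g).
  move=> hab' hw' c d hcd hwcd; apply: IH => //.
  have := perm_length_max (tperm a' b' * w)%g.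
  by move: hk; rewrite (perm_length_swap hab' hw'); lia.
have IH2 (a' b' : 'I_n) : b' = a'.+1 :> nat -> (w a' < w b')%N ->
    forall c d : 'I_n, d = c.+1 :> nat ->
    ((tperm a' b' * w)%g c < (tperm a' b' * w)%g d)%N ->
    forall e f : 'I_n, f = e.+1 :> nat ->
    ((tperm c d * (tperm a' b' * w))%g e < (tperm c d * (tperm a' b' * w))%g f)%N ->
    schubert (tperm c d * (tperm a' b' * w))%g =
      divdiff e f (schubert (tperm e f * (tperm c d * (tperm a' b' * w)))%g).
  move=> hab' hw' c d hcd hwcd e f hef hwef; apply: IH => //.
  have := perm_length_max (tperm c d * (tperm a' b' * w))%g; move: hk.
  by rewrite (perm_length_swap hcd hwcd) (perm_length_swap hab' hw'); lia.
have braid (a' b' c' : 'I_n) : b' = a'.+1 :> nat -> c' = b'.+1 :> nat ->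
    (w a' < w b')%N -> (w b' < w c')%N ->
    divdiff a' b' (schubert (tperm a' b' * w)%g) =
    divdiff b' c' (schubert (tperm b' c' * w)%g).
  move=> hab' hbc' h1 h2.
  have ab := adj_neq hab'; have bc := adj_neq hbc'.
  have ac : a' != c' by rewrite -val_eqE /= hbc' hab'; lia.
  have [ba cb ca] : [/\ b' != a', c' != b' & c' != a'] by split; rewrite eq_sym.
  (* Since [w] increases on the three positions, each of the two routes of three swaps climbs an
     ascent at every stage, and they end at the same permutation. *)
  have N := (negbTE ab, negbTE bc, negbTE ac, negbTE ba, negbTE cb, negbTE ca).
  have h3 := ltn_trans h1 h2.
  have l1 : ((tperm a' b' * w)%g b' < (tperm a' b' * w)%g c')%N.
    by rewrite !tperm_swapE !eqxx !N.
  have l2 : ((tperm b' c' * w)%g a' < (tperm b' c' * w)%g b')%N.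
    by rewrite !tperm_swapE !eqxx !N.
  have l3 : ((tperm b' c' * (tperm a' b' * w))%g a' <
             (tperm b' c' * (tperm a' b' * w))%g b')%N.
    by rewrite !tperm_swapE !eqxx !N.
  have l4 : ((tperm a' b' * (tperm b' c' * w))%g b' <
             (tperm a' b' * (tperm b' c' * w))%g c')%N.
    by rewrite !tperm_swapE !eqxx !N.
  rewrite (IH' _ _ hab' h1 _ _ hbc' l1) (IH2 _ _ hab' h1 _ _ hbc' l1 _ _ hab' l3).
  rewrite (IH' _ _ hbc' h2 _ _ hab' l2) (IH2 _ _ hbc' h2 _ _ hab' l2 _ _ hbc' l4).
  have E := congr1 (fun s => s * w)%g (tperm_braid ab bc ac).
  by rewrite -!mulgA in E; rewrite E; apply: divdiff_braid.
have commute (a0 b0 : 'I_n) : b0 = a0.+1 :> nat -> (w a0 < w b0)%N ->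
    a0 != a -> a0 != b -> b0 != a -> b0 != b ->
    divdiff a0 b0 (schubert (tperm a0 b0 * w)%g) =
    divdiff a b (schubert (tperm a b * w)%g).
  move=> hab0 hw0 n1 n2 n3 n4.
  have [m1 m2 m3 m4] : [/\ a != a0, b != a0, a != b0 & b != b0].
    by split; rewrite eq_sym.
  have N := (negbTE n1, negbTE n2, negbTE n3, negbTE n4,
             negbTE m1, negbTE m2, negbTE m3, negbTE m4).
  have l1 : ((tperm a0 b0 * w)%g a < (tperm a0 b0 * w)%g b)%N.
    by rewrite !tperm_swapE !N.
  have l2 : ((tperm a b * w)%g a0 < (tperm a b * w)%g b0)%N.
    by rewrite !tperm_swapE !N.
  rewrite (IH' _ _ hab0 hw0 _ _ hab l1) (IH' _ _ hab hw _ _ hab0 l2).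
  have E := congr1 (fun s => s * w)%g (tperm_comm n1 n2 n3 n4).
  rewrite -!mulgA in E; rewrite E.
  by apply: divdiff_comm => //; apply: adj_neq.
(* Having an ascent, [w] is not the longest element, so the recursion does pick some ascent to
   compare with. *)
have hwl : w != longest n.
  apply: contraTneq hw => ->; rewrite !longestE /= -leqNgt.
  by have := ltn_ord b; lia.
have [a0 [b0 [hab0 hw0 ->]]] := schubert_some_ascent hwl.
case: (ltngtP a0 a) => [lt|lt|/val_inj e].
- case: (ltngtP b0 a) => [lt'|lt'|/val_inj e]; [|lia|].
  + by apply: (commute a0 b0) => //; rewrite -val_eqE /=; lia.
  + by subst b0; rewrite (braid _ _ _ hab0 hab).
- case: (ltngtP b a0) => [lt'|lt'|/val_inj e]; [|lia|].
  + by apply: (commute a0 b0) => //; rewrite -val_eqE /=; lia.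
  + by subst a0; rewrite (braid _ _ _ hab hab0).
- by subst a0; rewrite (val_inj (etrans hab0 (esym hab))).
Qed.

Lemma divdiff_schubert_descent n (w : 'S_n) (a b : 'I_n) :
  b = a.+1 :> nat -> (w b < w a)%N ->
  divdiff a b (schubert w) = schubert (tperm a b * w)%g.
Proof.
move=> hab hw; rewrite (schubert_ascent (w := (tperm a b * w)%g) hab).
  by rewrite mulgA tperm2 mul1g.
by rewrite !permM tpermL tpermR.
Qed.

Lemma divdiff_schubert_ascent n (w : 'S_n) (a b : 'I_n) :
  b = a.+1 :> nat -> (w a < w b)%N -> divdiff a b (schubert w) = 0.
Proof.
by move=> hab hw; rewrite (schubert_ascent hab hw) divdiff_divdiff ?adj_neq.
Qed.

(** * Degrees, staircase support and normalization *)

Definition stair n (m : 'X_{1..n}) : Prop := forall i : 'I_n, (m i < n - i)%N.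

(** Both old exponents are at most [n - b], because [n - a] is one more; the new ones are strictly
    smaller, which is the bound at [b] and implies that at [a]. *)
Lemma divdiff_stair n (a b : 'I_n) f : b = a.+1 :> nat ->
  supported (@stair n) f -> supported (@stair n) (divdiff a b f).
Proof.
move=> hab /(divdiff_supported (adj_neq hab)); apply=> m m' hm [_ ha hb hi] i.
have := hm a; have := hm b; have := ltn_ord b.
case: (eqVneq i a) => [->|ia]; first by lia.
by case: (eqVneq i b) => [->|ib]; [lia | rewrite hi].
Qed.

Lemma divdiff_homog n (a b : 'I_n) f d : b = a.+1 :> nat ->
  supported (fun m : 'X_{1..n} => mdeg m = d.+1) f ->
  supported (fun m => mdeg m = d) (divdiff a b f).
Proof.
move=> hab /(divdiff_supported (adj_neq hab)); apply=> m m' hm [h _ _ _].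
by apply: succn_inj; rewrite h.
Qed.

Lemma perm_ascent_ind n (P : 'S_n -> Prop) : P (longest n) ->
  (forall (w : 'S_n) (a b : 'I_n), b = a.+1 :> nat -> (w a < w b)%N ->
     P (tperm a b * w)%g -> P w) ->
  forall w, P w.
Proof.
move=> P0 PS w; have [k] := ubnP (perm_length (longest n) - perm_length w)%N.
elim: k w => // k IH w hk; case: (longest_or_ascent w) => [->//|].
move=> [a [b [hab hw]]]; apply: (PS w a b) => //; apply: IH.
have := perm_length_max (tperm a b * w)%g; move: hk.
by rewrite (perm_length_swap hab hw); lia.
Qed.

Lemma schubert_stair n (w : 'S_n) : supported (@stair n) (schubert w).
Proof.
elim/perm_ascent_ind: w => [|w a b hab hw IH].
  rewrite schubert_longest; apply: supportedX => i.
  by rewrite mnmE; have := ltn_ord i; lia.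
by rewrite (schubert_ascent hab hw); apply: divdiff_stair.
Qed.

Lemma schubert_homog n (w : 'S_n) :
  supported (fun m => mdeg m = perm_length w) (schubert w).
Proof.
elim/perm_ascent_ind: w => [|w a b hab hw IH].
  rewrite schubert_longest; apply: supportedX.
  by rewrite perm_length_longest mdegE; apply: eq_bigr => i _; rewrite mnmE.
rewrite (schubert_ascent hab hw); apply: divdiff_homog => //.
by rewrite -(perm_length_swap hab hw).
Qed.

(** * Constant terms, and the Schubert polynomial of the identity *)

Definition eps n (f : {mpoly int[n]}) : int := f.@[fun=> 0].

Lemma eps_pos_degree n (f : {mpoly int[n]}) :
  supported (fun m => 0 < mdeg m)%N f -> eps f = 0.
Proof.
move=> h; rewrite /eps mevalE big_seq big1 // => m /h.
rewrite lt0n mdegE sum_nat_eq0 negb_forall => /existsP [i /= hi].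
by rewrite (bigD1 i) //= expr0n (negbTE hi) mul0r mulr0.
Qed.

Lemma mpolyX_neq0 n (m : 'X_{1..n}) : 'X_[m] != 0 :> {mpoly int[n]}.
Proof. by rewrite -msupp_eq0 msuppX. Qed.

Lemma divdiff_monomial n (a b : 'I_n) (m : 'X_{1..n}) : a != b ->
  m a = (m b).+1 -> divdiff a b 'X_[m] = 'X_[m - U_(a)].
Proof.
move=> ab hm; apply: (divdiff_uniq ab).
have ba : b != a by rewrite eq_sym.
rewrite mulrBr -!mpolyXD submK; last by rewrite lep1mP hm.
congr (_ - _); rewrite msymX tpermV; congr mpolyX; apply/mnmP => i.
rewrite mnmDE mnmBE mnmE !mnm1E.
by case: (tpermP a b i) => [->|->|/eqP ia /eqP ib];
  rewrite ?eqxx ?(negbTE ab) ?(negbTE ba) ?[a == i]eq_sym ?[b == i]eq_sym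
    ?(negbTE ia) ?(negbTE ib) ?hm; lia.
Qed.

(* Divided differences at a position with exponent one more than the next
   lower that exponent by one; starting from the staircase one can stay among
   monomials whose consecutive exponents drop by 0 or 1, down to 1. *)
Definition gentle n (m : 'X_{1..n}) : Prop :=
  (forall a b : 'I_n, b = a.+1 :> nat -> (m b <= m a <= (m b).+1)%N) /\
  (forall i : 'I_n, i.+1 = n -> m i = 0%N).

(** The exponents end at 0, so a nonzero monomial drops somewhere. At the first drop the preceding
    exponent, if any, equals that of [a], so lowering it creates a difference of only one. *)
Lemma gentle_drop n (m : 'X_{1..n}) : gentle m -> m != 0%MM ->
  exists a b : 'I_n, [/\ b = a.+1 :> nat, m a = (m b).+1 & gentle (m - U_(a))].
Proof.
move=> [h1 h2] m0.
pose drop (a : 'I_n) := [exists b : 'I_n, (b == a.+1 :> nat) && (m b < m a)%N].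
have [a0 ha0] : exists a, drop a.
  apply/existsP; apply: contraR m0 => /existsPn hn; apply/eqP/mnmP => i.
  rewrite mnm0E; have [k] := ubnP (n - i); elim: k i => // k IH i hk.
  have := ltn_ord i; rewrite leq_eqVlt => /orP [/eqP /h2 //|hi].
  have hb := IH (Ordinal hi); have := hn i; rewrite negb_exists => /forallP /(_ (Ordinal hi)).
  by rewrite eqxx /= hb /=; lia.
have [a /existsP [b /andP [/eqP hab hlt]] amin] := arg_minnP (fun i : 'I_n => i : nat) ha0.
exists a, b; split => //; first by have := h1 _ _ hab; lia.
split=> [c d hcd|i hi]; last by rewrite mnmBE h2.
have hc := h1 _ _ hcd; have ha := h1 _ _ hab; rewrite !mnmBE !mnm1E.
case: (eqVneq a c) => [e|ac].
  have -> : d = b by apply: val_inj; rewrite /= hcd hab e.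
  by rewrite (negbTE (adj_neq hab)) -e; lia.
case: (eqVneq a d) => [e|_]; last by lia.
have : ~~ drop c by apply/negP => /amin; rewrite e hcd; lia.
rewrite negb_exists => /forallP /(_ d); rewrite hcd eqxx /= -e.
by rewrite -e in hc; lia.
Qed.

(** Descends from the staircase through gentle monomials, each the Schubert polynomial of some [w].
    On reaching the monomial 1, homogeneity forces [w] to have length 0. *)
Lemma schubert1 n : schubert (1%g : 'S_n) = 1.
Proof.
suff H (m : 'X_{1..n}) w : gentle m -> schubert w = 'X_[m] -> schubert (1%g : 'S_n) = 1.
  apply: (H _ _ _ (schubert_longest n)); split => [a b hab|i hi]; rewrite !mnmE; last by lia.
  by have := ltn_ord b; lia.
have [k] := ubnP (mdeg m); elim: k m w => // k IH m w hk hm hw.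
have [m0|m0] := eqVneq m 0%MM.
  have hw1 : schubert w = 1 by rewrite hw m0 mpolyX0.
  rewrite -hw1; apply: (congr1 (@schubert n)); apply/esym/perm_length_eq0.
  rewrite -(@schubert_homog n w m); first by rewrite m0 mdeg0.
  by rewrite hw msuppX mem_seq1.
have [a [b [hab hab' hg]]] := gentle_drop hm m0.
apply: (IH (m - U_(a))%MM (tperm a b * w)%g) => //.
  have := mdegD (m - U_(a))%MM U_(a)%MM.
  by rewrite submK ?lep1mP ?hab' // mdeg1 => h; rewrite h addn1 in hk.
rewrite -(divdiff_monomial (adj_neq hab) hab') -hw divdiff_schubert_descent //.
(* At an ascent of [w] the divided difference would vanish, but here it is a monomial; so [w]
   descends. *)
case: (ltngtP (w a) (w b)) => // [lt|/val_inj /perm_inj e].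
  have := divdiff_schubert_ascent hab lt.
  by rewrite hw divdiff_monomial ?adj_neq // => /eqP; rewrite (negbTE (mpolyX_neq0 _)).
by have := adj_neq hab; rewrite e eqxx.
Qed.

Lemma eps_schubert n (w : 'S_n) : eps (schubert w) = (w == 1%g)%:R.
Proof.
have [->|hw] := eqVneq w 1%g; first by rewrite schubert1 /eps meval1.
apply: eps_pos_degree => m /schubert_homog ->; rewrite lt0n.
by apply: contraNneq hw => /perm_length_eq0 ->.
Qed.

(** * Expansion in Schubert polynomials *)

(* The constant term of the divided difference along a reduced word of [w];
   it reads off the coefficient of [schubert w]. *)
Fixpoint schubert_coef_rec n (k : nat) (w : 'S_n) (f : {mpoly int[n]}) : int :=
  if k is k'.+1 then
    if [pick p : 'I_n * 'I_n | (p.2 == p.1.+1 :> nat) && (w p.2 < w p.1)%N]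
       is Some p
    then schubert_coef_rec k' (tperm p.1 p.2 * w)%g (divdiff p.1 p.2 f)
    else 0
  else eps f.

Definition schubert_coef n (w : 'S_n) : {mpoly int[n]} -> int :=
  schubert_coef_rec (perm_length w) w.

Lemma schubert_coef_step n (w : 'S_n) : w != 1%g ->
  exists a b : 'I_n, [/\ b = a.+1 :> nat, (w b < w a)%N &
    schubert_coef w = schubert_coef (tperm a b * w)%g \o divdiff a b].
Proof.
move=> hw; case: (id_or_descent w) => [h|]; first by rewrite h eqxx in hw.
move=> [a0 [b0 [hab0 hw0]]].
rewrite /schubert_coef (perm_length_unswap hab0 hw0) /=.
case: pickP => [[a b] /= /andP [/eqP hab hwab]|]; last first.
  by move=> /(_ (a0, b0)); rewrite /= hab0 eqxx hw0.
exists a, b; split; [exact: hab | exact: hwab |].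
suff -> : perm_length (tperm a0 b0 * w)%g = perm_length (tperm a b * w)%g by [].
by apply: succn_inj; rewrite -!perm_length_unswap.
Qed.

(** Hides which descent the recursion picks: a property is proved for every descent and an abstract
    functional [g]. *)
Lemma schubert_coef_ind n (P : 'S_n -> ({mpoly int[n]} -> int) -> Prop) :
  P 1%g (@eps n) ->
  (forall (w : 'S_n) (a b : 'I_n) g, b = a.+1 :> nat -> (w b < w a)%N ->
     P (tperm a b * w)%g g -> P w (g \o divdiff a b)) ->
  forall w, P w (schubert_coef w).
Proof.
move=> P1 PS w; have [k] := ubnP (perm_length w); elim: k w => // k IH w hk.
have [->|hw] := eqVneq w 1%g.
  by rewrite /schubert_coef perm_length1.
have [a [b [hab hlt ->]]] := schubert_coef_step hw.
by apply: PS => //; apply: IH; rewrite (perm_length_unswap hab hlt) in hk.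
Qed.

Lemma schubert_coef_linear n (w : 'S_n) c f g :
  schubert_coef w (c *: f + g) = c * schubert_coef w f + schubert_coef w g.
Proof.
elim/schubert_coef_ind: w / (schubert_coef w) f g => [f g|w a b h hab _ IH f g].
  by rewrite /eps mevalD mevalZ.
by have ab := adj_neq hab; rewrite /= divdiffD // divdiffZ // IH.
Qed.

Lemma schubert_coef0 n (w : 'S_n) : schubert_coef w 0 = 0.
Proof.
have := schubert_coef_linear w 1 0 0; rewrite scale1r addr0 mul1r.
by move=> /eqP; rewrite -subr_eq0 opprD addNKr oppr_eq0 => /eqP.
Qed.

Lemma schubert_coefD n (w : 'S_n) f g :
  schubert_coef w (f + g) = schubert_coef w f + schubert_coef w g.
Proof. by rewrite -[f in LHS]scale1r schubert_coef_linear mul1r. Qed.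

Lemma schubert_coefZ n (w : 'S_n) c f :
  schubert_coef w (c *: f) = c * schubert_coef w f.
Proof. by rewrite -[c *: f]addr0 schubert_coef_linear schubert_coef0 addr0. Qed.

Lemma schubert_coef_sum n (w : 'S_n) (I : Type) (r : seq I) (Q : pred I) F :
  schubert_coef w (\sum_(i <- r | Q i) F i) = \sum_(i <- r | Q i) schubert_coef w (F i).
Proof.
exact: (big_morph (schubert_coef w) (schubert_coefD w) (schubert_coef0 w)).
Qed.

(** At a descent of [w], either [u] ascends, so that the divided difference is 0 and [u] differs
    from [w], or both undergo the same swap. *)
Lemma schubert_coef_schubert n (w u : 'S_n) :
  schubert_coef w (schubert u) = (w == u)%:R.
Proof.
(* The clause [h 0 = 0] is carried along because the functional is abstract in the induction and the
   ascent case evaluates it at 0. *)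
pose P (w : 'S_n) (h : {mpoly int[n]} -> int) :=
  h 0 = 0 /\ forall u, h (schubert u) = (w == u)%:R.
suff [] : P w (schubert_coef w) by [].
elim/schubert_coef_ind: w / (schubert_coef w) => [|w a b h hab hw [h0 IH]].
  by split=> [|v]; [rewrite /eps meval0 | rewrite eps_schubert eq_sym].
have ab := adj_neq hab; split=> [|v] /=; first by rewrite divdiff0.
case: (ltngtP (v a) (v b)) => [lt|gt|/val_inj /perm_inj e].
- rewrite divdiff_schubert_ascent // h0.
  by case: eqP => [e|//]; move: hw; rewrite e ltnNge ltnW.
- rewrite divdiff_schubert_descent // IH; congr (nat_of_bool _)%:R.
  by apply/eqP/eqP => [/mulgI|->].
- by rewrite e eqxx in ab.
Qed.

Lemma schubert_coef_pos_degree n (w : 'S_n) d f : (perm_length w < d)%N ->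
  supported (fun m => mdeg m = d) f -> schubert_coef w f = 0.
Proof.
elim/schubert_coef_ind: w / (schubert_coef w) d f => [d f|w a b h hab hw IH [//|d] f] hd hf.
  by apply: eps_pos_degree => m /hf ->; rewrite -(perm_length1 n).
apply: (IH d); first by rewrite (perm_length_unswap hab hw) in hd.
exact: divdiff_homog.
Qed.

(** * The functionals vanish on the flag ideal *)

Lemma flag_idealP n (f : {mpoly int[n]}) : reflect
  (exists g : 'I_n -> {mpoly int[n]}, f = \sum_(i < n) g i * mesym n int i.+1)
  (f \in @flag_ideal n).
Proof. exact: asboolP. Qed.

Lemma divdiff_flag_ideal n (a b : 'I_n) f : a != b ->
  f \in @flag_ideal n -> divdiff a b f \in @flag_ideal n.
Proof.
move=> ab /flag_idealP [g ->]; apply/flag_idealP.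
exists (fun i => divdiff a b (g i)); rewrite divdiff_sum //.
apply: eq_bigr => i _; rewrite divdiffM_sym //.
by apply/issymP/mesym_sym.
Qed.

Lemma eps_flag_ideal n f : f \in @flag_ideal n -> eps f = 0.
Proof.
move=> /flag_idealP [g ->]; rewrite /eps raddf_sum big1 // => i _ /=.
by rewrite mevalM mesymS_at0 mulr0.
Qed.

Lemma schubert_coef_flag_ideal n (w : 'S_n) f :
  f \in @flag_ideal n -> schubert_coef w f = 0.
Proof.
elim/schubert_coef_ind: w / (schubert_coef w) f => [f|w a b h hab _ IH f hf].
  exact: eps_flag_ideal.
by apply: IH; apply: divdiff_flag_ideal => //; apply: adj_neq.
Qed.

(** A one-sided inverse of a square matrix over a commutative ring is two-sided; enumerating [I] and
    [J] by the same ordinals makes the matrices square. *)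
Lemma biorthogonal_sym (R : comNzRingType) (I J : finType) (a : I -> J -> R)
    (b : J -> I -> R) : #|I| = #|J| ->
  (forall i i', \sum_j a i j * b j i' = (i == i')%:R) ->
  forall j j', \sum_i b j i * a i j' = (j == j')%:R.
Proof.
move=> eIJ ab j j'.
pose f (k : 'I_#|I|) : J := enum_val (cast_ord eIJ k).
have fbij : bijective f.
  exists (fun j => cast_ord (esym eIJ) (enum_rank j)) => x; rewrite /f.
    by rewrite enum_valK cast_ordK.
  by rewrite cast_ordKV enum_rankK.
pose A := \matrix_(k < #|I|, l < #|I|) a (enum_val k) (f l).
pose B := \matrix_(k < #|I|, l < #|I|) b (f k) (enum_val l).
have AB : A *m B = 1%:M.
  apply/matrixP => k l; rewrite !mxE -(inj_eq enum_val_inj) -ab.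
  by rewrite [RHS](reindex f (onW_bij _ fbij)); apply: eq_bigr => i _; rewrite !mxE.
have [g fK gK] := fbij.
have /matrixP /(_ (g j) (g j')) := mulmx1C AB.
rewrite !mxE (inj_eq (can_inj gK)) => <-.
rewrite (reindex enum_val (onW_bij _ (enum_val_bij _))).
by apply: eq_bigr => i _; rewrite !mxE !gK.
Qed.

(** A finite type of staircase exponents; as a dependent product its cardinality is visibly [n!]. *)
Definition stairs n := {dffun forall i : 'I_n, 'I_(n - i)}.

Definition stairs_mnm n (s : stairs n) : 'X_{1..n} := [multinom (s i : nat) | i < n].

Lemma card_stairs n : #|stairs n| = n`!.
Proof.
rewrite card_dep_ffun foldrE big_map big_enum -ffactnn ffact_prod.
by apply: eq_bigr => i _; rewrite card_ord.
Qed.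

Lemma stairs_mnm_inj n : injective (@stairs_mnm n).
Proof.
move=> s t h; apply/ffunP => i; apply: val_inj.
by have := congr1 (fun m : 'X_{1..n} => m i) h; rewrite !mnmE.
Qed.

Lemma stairs_mnm_surj n (m : 'X_{1..n}) : stair m -> exists s, m = stairs_mnm s.
Proof.
move=> hm; exists [ffun i : 'I_n => Ordinal (hm i)].
by apply/mnmP => i; rewrite mnmE ffunE.
Qed.

Lemma stair_expansion n (f : {mpoly int[n]}) : supported (@stair n) f ->
  f = \sum_s f@_(stairs_mnm s) *: 'X_[stairs_mnm s].
Proof.
move=> hf; apply/mpolyP => m; rewrite raddf_sum /=.
have [hm|hm] := boolP (m \in msupp f).
  have [s ->] := stairs_mnm_surj (hf _ hm).
  rewrite (bigD1 s) //= mcoeffZ mcoeffX eqxx mulr1 big1 ?addr0 // => t ts.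
  by rewrite mcoeffZ mcoeffX (inj_eq (@stairs_mnm_inj n)) (negbTE ts) mulr0.
rewrite (memN_msupp_eq0 hm) big1 // => s _; rewrite mcoeffZ mcoeffX.
by case: eqP => [e|]; rewrite ?mulr0 // e (memN_msupp_eq0 hm) mul0r.
Qed.

(* The n! Schubert polynomials lie in the span of the n! staircase monomials
   and admit the dual functionals [schubert_coef]; a square integer matrix
   with a one-sided inverse is invertible. *)
Lemma schubert_expansion n (f : {mpoly int[n]}) : supported (@stair n) f ->
  f = \sum_w schubert_coef w f *: schubert w.
Proof.
move=> hf.
have card : #|'S_n| = #|stairs n|.
  by rewrite card_stairs card_Sn.
have dual : forall s t : stairs n,
    \sum_w schubert_coef w 'X_[stairs_mnm s] * (schubert w)@_(stairs_mnm t) = (s == t)%:R.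
  apply: biorthogonal_sym => // u w; rewrite eq_sym -schubert_coef_schubert.
  rewrite {2}(stair_expansion (@schubert_stair n u)) schubert_coef_sum.
  by apply: eq_bigr => s _; rewrite schubert_coefZ.
(* Both sides are staircase polynomials, so it suffices to compare staircase coefficients, which
   [dual] provides. *)
have mon (s : stairs n) :
    'X_[stairs_mnm s] = \sum_w schubert_coef w 'X_[stairs_mnm s] *: schubert w.
  set r := RHS; have hr : supported (@stair n) r.
    by apply: supported_sum => w _; apply: supportedZ; apply: schubert_stair.
  have rE t : r@_(stairs_mnm t) = (s == t)%:R.
    by rewrite /r raddf_sum -dual; apply: eq_bigr => w _; rewrite /= mcoeffZ.
  rewrite (stair_expansion hr) (bigD1 s) //= big1 => [|t ts].
    by rewrite rE eqxx scale1r addr0.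
  by rewrite rE eq_sym (negbTE ts) scale0r.
rewrite {1}(stair_expansion hf).
under eq_bigr do rewrite mon scaler_sumr.
rewrite exchange_big; apply: eq_bigr => w _ /=.
rewrite {2}(stair_expansion hf) schubert_coef_sum scaler_suml.
by apply: eq_bigr => s _; rewrite schubert_coefZ scalerA.
Qed.

Lemma stair_flag_ideal_eq0 n (f : {mpoly int[n]}) :
  supported (@stair n) f -> f \in @flag_ideal n -> f = 0.
Proof.
move=> hs hf; rewrite (schubert_expansion hs) big1 // => w _.
by rewrite schubert_coef_flag_ideal // scale0r.
Qed.

(** * Normal forms modulo the flag ideal *)

Section CompleteSymmetric.
Variable n : nat.
Local Notation P := {mpoly int[n]}.
Local Notation I := (@flag_ideal n).

(** Modulo the ideal [tailp 0] is 1, so [tailp i] becomes the inverse of the complementary product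
    over [j < i], the generating function of complete symmetric polynomials. *)
Let tailp (i : nat) : {poly P} := \prod_(j < n | (i <= j)%N) (1 - 'X_j *: 'X).

Let tailp_rec (i : 'I_n) : tailp i = (1 - 'X_i *: 'X) * tailp i.+1.
Proof.
rewrite /tailp (bigD1 i) //=; congr (_ * _); apply: eq_bigl => j.
by rewrite -val_eqE /=; lia.
Qed.

Let tailp_coef0 i : (tailp i)`_0 = 1.
Proof.
rewrite /tailp coef0_prod big1 // => j _.
by rewrite coefB coef1 coefZ coefX mulr0 subr0.
Qed.

Let tailp_coefS (i : 'I_n) k :
  (tailp i)`_k.+1 = (tailp i.+1)`_k.+1 - 'X_i * (tailp i.+1)`_k.
Proof. by rewrite tailp_rec mulrBl mul1r -scalerAl coefB coefZ coefXM. Qed.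

Let size_tailp i : (i <= n)%N -> (size (tailp i) <= (n - i).+1)%N.
Proof.
move=> hi; rewrite -{1}(subKn hi); have := leq_subr i n.
elim: (n - i)%N => [_|d IH hd].
  by rewrite subn0 /tailp big1 ?size_poly1 // => j; have := ltn_ord j; lia.
have hlt : (n - d.+1 < n)%N by lia.
rewrite (tailp_rec (Ordinal hlt)) /= (_ : (n - d.+1).+1 = (n - d)%N); last by lia.
apply: leq_trans (size_polyMleq _ _) _.
have s1 : (size (1 - 'X_(Ordinal hlt) *: 'X : {poly P})%R <= 2)%N.
  apply: leq_trans (size_polyD _ _) _; rewrite size_poly1 size_polyN geq_max /=.
  by apply: leq_trans (size_scale_leq _ _) _; rewrite size_polyX.
by move: s1 (IH (ltnW hd)); move: (size _) (size _) => x y; lia.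
Qed.

Let tailp0_coef k : (tailp 0)`_k = (-1) ^+ k * mesym n int k.
Proof.
rewrite /tailp (eq_bigr (fun j => - 'X_j *: 'X + 1)); last first.
  by move=> j _; rewrite scaleNr addrC.
rewrite bigA_distr coef_sum /mesym mulr_sumr [RHS]big_mkcond /=.
apply: eq_bigr => h _; rewrite -big_mkcond /= scaler_prod prodrN prodr_const.
rewrite coefZ coefXn eq_sym; case: eqP => [->|_]; last by rewrite mulr0.
by rewrite mulr1.
Qed.

(* The coefficients of [prod_(j >= i) (1 - x_j T)] obey the recursion of the
   complete symmetric polynomials in [x_0, ..., x_(i-1)], and start from
   [(-1)^k e_k]: modulo the ideal the two families agree. *)
Let complete_sym_ex i k : (i <= n)%N -> exists h : P,
  [/\ h - (tailp i)`_k \in I,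
      supported (fun m => mdeg m = k /\
        ((0 < k)%N -> exists2 j : 'I_n, (j < i)%N & (0 < m j)%N)) h &
      forall i' : 'I_n, i = i'.+1 ->
        supported (fun m => mdeg m = k /\ exists2 j : 'I_n, (j < i')%N & (0 < m j)%N)
          (h - 'X_i' ^+ k)].
Proof.
elim: i k => [|i IH] k hi.
  (* With no variables the complete symmetric polynomials are 1, 0, 0, and so on; the positive
     coefficients of [tailp 0] are signed elementary polynomials, zero beyond degree [n]. *)
  case: k => [|k]; [exists 1|exists 0]; split => //.
  - by rewrite tailp_coef0 subrr rpred0.
  - by rewrite -mpolyX0; apply: supportedX; rewrite mdeg0.
  - rewrite tailp0_coef sub0r rpredN idealMr //; apply/flag_idealP.
    have [hk|hk] := ltnP k n.
      exists (fun j => (j == Ordinal hk)%:R).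
      rewrite (bigD1 (Ordinal hk)) //= eqxx mul1r big1 ?addr0 // => j /negbTE ->.
      by rewrite mul0r.
    by exists (fun=> 0); rewrite mesym_geqnE // big1 // => j _; rewrite mul0r.
  - by move=> m; rewrite msupp0.
pose i' := Ordinal hi.
(* The last clause implies the support clause: the power of ['X_i'] itself involves a variable of
   index below [i.+1]. *)
suff [h [h1 h2]] : exists h : P, h - (tailp i.+1)`_k \in I /\
    supported (fun m => mdeg m = k /\ exists2 j : 'I_n, (j < i)%N & (0 < m j)%N)
          (h - 'X_i' ^+ k).
  exists h; split => // [|j [ej]]; last first.
    by have -> : j = i' by apply: val_inj.
  rewrite -[h](subrK ('X_i' ^+ k)); apply: supportedD => [m /h2 [hm [j hj mj]]|].
    by split=> // _; exists j => //; apply: ltnW.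
  rewrite mpolyXn; apply: supportedX; rewrite mdegMn mdeg1 mul1n; split=> // hk.
  by exists i'; rewrite //= mulmnE mnm1E eqxx mul1n.
elim: k => [|k [h [h1 h2]]].
  exists 1; rewrite tailp_coef0 expr0 subrr; split; first exact: rpred0.
  by move=> m; rewrite msupp0.
have [g [g1 g2 _]] := IH k.+1 (ltnW hi).
(* The recursion for complete symmetric polynomials: either [x_i] does not occur, or one factor
   [x_i] is split off. *)
exists (g + 'X_i' * h); split.
  have := tailp_coefS i' k; rewrite /= => e.
  have -> : g + 'X_i' * h - (tailp i.+1)`_k.+1 =
     (g - (tailp i)`_k.+1) + 'X_i' * (h - (tailp i.+1)`_k) by rewrite e; ring.
  by rewrite rpredD // idealMr.
have -> : g + 'X_i' * h - 'X_i' ^+ k.+1 = g + 'X_i' * (h - 'X_i' ^+ k).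
  by rewrite exprS; ring.
apply: supportedD => [m /g2 [hm]|]; first by move=> /(_ isT).
apply: (supportedM (P := fun m => m = U_(i')%MM) _ h2).
  exact: supportedX.
move=> m m' -> [hm' [j hj mj]]; split; first by rewrite mdegD mdeg1 hm'.
by exists j; rewrite // mnmDE addn_gt0 mj orbT.
Qed.

(** [tailp i.+1] has degree at most [n - i - 1] in the auxiliary variable, so its coefficient at
    [n - i] is 0 and the corresponding complete symmetric polynomial lies in the ideal. *)
Lemma flag_ideal_power (i : 'I_n) : exists2 h : P, h \in I &
  supported (fun m => mdeg m = (n - i)%N /\
    exists2 j : 'I_n, (j < i)%N & (0 < m j)%N) (h - 'X_[U_(i) *+ (n - i)]).
Proof.
have [h [h1 _ /(_ i erefl) h2]] := complete_sym_ex (n - i) (ltn_ord i).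
exists h; last by rewrite -mpolyXn.
move: h1; rewrite nth_default ?subr0 //; apply: leq_trans (size_tailp (ltn_ord i)) _.
by have := ltn_ord i; lia.
Qed.

End CompleteSymmetric.

(** * The term order and reduction to staircase polynomials *)

Lemma drl_ltE n (m1 m2 : 'X_{1..n}) : drl_lt m1 m2 =
  (mdeg m1 < mdeg m2)%N || ((mdeg m1 == mdeg m2) && (m2 < m1)%O).
Proof.
rewrite /drl_lt; congr (_ || _); case: eqP => //= e.
apply/existsP/(ltmcP (esym e)) => [[i /andP [h1 /forallP h2]]|[i h1 h2]]; exists i => //.
  by move=> j hj; have := h2 j; rewrite hj => /eqP.
by rewrite h2; apply/forallP => j; apply/implyP => /h1 ->.
Qed.

Lemma drl_lt_trans n : transitive (@drl_lt n).
Proof.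
move=> y x z; rewrite !drl_ltE => /orP [h|/andP [/eqP h1 h2]] /orP [h'|/andP [/eqP h1' h2']].
- by rewrite (ltn_trans h h').
- by rewrite -h1' h.
- by rewrite h1 h'.
- by rewrite h1 h1' eqxx (lt_trans h2' h2) orbT.
Qed.

Lemma drl_lt_irr n (m : 'X_{1..n}) : drl_lt m m = false.
Proof. by rewrite drl_ltE ltnn ltxx andbF. Qed.

Lemma drl_lt_total n (m1 m2 : 'X_{1..n}) : m1 != m2 -> drl_lt m1 m2 || drl_lt m2 m1.
Proof.
move=> h; rewrite !drl_ltE; case: ltngtP => //= _.
by rewrite -neq_lt eq_sym.
Qed.

Lemma drl_lead_ex n (f : {mpoly int[n]}) : f != 0 -> exists m, is_drl_lead f m.
Proof.
rewrite -msupp_eq0 /is_drl_lead; elim: (msupp f) => // x s IH _.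
case: (eqVneq s [::]) => [->|/IH [m [hm max]]].
  by exists x; rewrite mem_head; split => // m'; rewrite inE => /eqP ->; rewrite eqxx.
have [e|/drl_lt_total /orP [lt|lt]] := eqVneq x m.
- exists m; rewrite inE hm orbT; split => // m'.
  by rewrite inE => /orP [/eqP ->|/max //]; rewrite e eqxx.
- exists m; rewrite inE hm orbT; split => // m'.
  by rewrite inE => /orP [/eqP ->|/max].
- exists x; rewrite mem_head; split => // m'.
  rewrite inE => /orP [/eqP ->|]; first by rewrite eqxx.
  have [->//|ne] := eqVneq m' m => hm' _; apply: drl_lt_trans lt; exact: max.
Qed.

Lemma flag_ideal_sum n (J : eqType) (r : seq J) (F : J -> {mpoly int[n]}) :
  (forall j, j \in r -> F j \in @flag_ideal n) -> \sum_(j <- r) F j \in @flag_ideal n.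
Proof. by move=> h; rewrite big_seq; apply: rpred_sum. Qed.

(** Some exponent reaches [n - i]; [flag_ideal_power] trades that power of [x_i] for monomials
    involving an earlier variable, which are smaller in the term order. *)
Lemma reduce_step n (m : 'X_{1..n}) : ~ stair m -> exists2 g : {mpoly int[n]},
  'X_[m] - g \in @flag_ideal n &
  supported (fun m' => mdeg m' = mdeg m /\ drl_lt m' m) g.
Proof.
move=> hm; have [i hi] : exists i : 'I_n, (n - i <= m i)%N.
  by apply/not_existsP => h; apply: hm => i; rewrite ltnNge; apply/negP/h.
have [h hI hh] := flag_ideal_power i.
have hle : (U_(i) *+ (n - i) <= m)%MM.
  apply/mnm_lepP => j; rewrite mulmnE mnm1E.
  by case: eqP => [<-|_]; rewrite ?mul1n ?mul0n.
set m0 := (m - U_(i) *+ (n - i))%MM; have em : (m0 + U_(i) *+ (n - i))%MM = m by rewrite submK.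
exists (- ('X_[m0] * (h - 'X_[U_(i) *+ (n - i)]))).
  rewrite opprK mulrBr -mpolyXD em addrC subrK.
  by rewrite idealMr.
apply: supportedN; apply: (supportedM (P := fun m => m = m0) _ hh).
  exact: supportedX.
move=> _ s -> [ds [j0 hj0 sj0]].
have ed : mdeg (m0 + s)%MM = mdeg m.
  by rewrite -em !mdegD ds mdegMn mdeg1 mul1n.
split=> //; rewrite /drl_lt ed eqxx ltnn /=; apply/existsP.
(* The first variable of [s] precedes [i], so removing the power of [x_i] has no effect up to there
   and [j] is the first place where the exponents differ. *)
have [j hj jmin] := arg_minnP (P := fun j : 'I_n => 0 < s j)%N (fun j : 'I_n => j : nat) sj0.
have eqm (l : 'I_n) : (l < i)%N -> (m0 + s)%MM l = (m l + s l)%N.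
  move=> hl; rewrite mnmDE /m0 mnmBE mulmnE mnm1E.
  by case: eqP hl => [->|_ _]; rewrite ?ltnn // mul0n subn0.
have hji : (j < i)%N by apply: leq_ltn_trans hj0; apply: jmin.
exists j; rewrite eqm //; apply/andP; split; first by lia.
apply/forallP => l; apply/implyP => hl; rewrite eqm; last exact: ltn_trans hji.
have [|] := posnP (s l); first by lia.
by move=> /jmin; rewrite leqNgt hl.
Qed.

Lemma reduce_monomial n (m : 'X_{1..n}) : exists r : {mpoly int[n]},
  [/\ 'X_[m] - r \in @flag_ideal n, supported (@stair n) r,
      supported (fun m' => m' = m \/ drl_lt m' m) r & stair m -> r = 'X_[m]].
Proof.
(* Reduction preserves the degree, so the number of smaller monomials of degree at most [d] is a
   finite measure that decreases. *)
pose below d (m : 'X_{1..n}) := #|[pred m' : 'X_{1..n < d.+1} | drl_lt (m' : 'X_{1..n}) m]|.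
have [d] : {d | mdeg m = d} by exists (mdeg m).
have [k] := ubnP (below d m); elim: k m => // k IH m hk hd.
have [hm|hm] := pselect (stair m).
  exists 'X_[m]; split => //; last by apply: supportedX; left.
    by rewrite subrr rpred0.
  exact: supportedX.
have [g gI gs] := reduce_step hm.
(* Membership in the support stands under the existential so that [choice] gives a function of all
   monomials. *)
have step m' : exists r : {mpoly int[n]}, m' \in msupp g ->
    [/\ 'X_[m'] - r \in @flag_ideal n, supported (@stair n) r &
        supported (fun m'' => m'' = m' \/ drl_lt m'' m') r].
  have [/gs [h1 h2]|_] := boolP (m' \in msupp g); last by exists 0.
  have [||r [r1 r2 r3 _]] := IH m'; last by exists r.
  - rewrite -ltnS; apply: leq_trans hk; rewrite ltnS; apply/proper_card/properP; split.
      by apply/fintype.subsetP => x; rewrite !inE => /drl_lt_trans; apply.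
    have hb : (mdeg m' < d.+1)%N by rewrite h1 hd.
    by exists (BMultinom hb); rewrite !inE //= drl_lt_irr.
  - by rewrite h1.
have [r hr] := choice step.
exists (\sum_(m' <- msupp g) g@_m' *: r m'); split => //.
- rewrite -[_ - _](subrKA g); apply: rpredD => //.
  rewrite {1}[g]mpolyE -sumrB; apply: flag_ideal_sum => m' /hr [h1 _ _].
  by rewrite -scalerBr -mul_mpolyC idealMr.
- by apply: supported_sum_seq => m' /hr [_ h _]; apply: supportedZ.
- apply: supported_sum_seq => m' hm'; have [_ _ h] := hr _ hm'.
  apply: supportedZ => m'' /h [->|lt]; right; first by case: (gs _ hm').
  by apply: drl_lt_trans lt _; case: (gs _ hm').
Qed.

(** A staircase leading monomial reduces to itself, and the other monomials only reduce to terms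
    below it, so its coefficient survives. *)
Lemma reduce_flag_ideal n (f : {mpoly int[n]}) : exists r : {mpoly int[n]},
  [/\ f - r \in @flag_ideal n, supported (@stair n) r &
      forall m, is_drl_lead f m -> stair m -> r@_m = f@_m].
Proof.
have [r hr] := choice (@reduce_monomial n).
exists (\sum_(m <- msupp f) f@_m *: r m); split.
- rewrite {1}[f]mpolyE -sumrB; apply: flag_ideal_sum => m _.
  by case: (hr m) => h _ _ _; rewrite -scalerBr -mul_mpolyC idealMr.
- by apply: supported_sum => m _; apply: supportedZ; case: (hr m).
move=> m [hm max] sm; rewrite raddf_sum (bigD1_seq m) ?msupp_uniq //=.
rewrite big_seq_cond big1 ?addr0 => [|m' /andP [hm' ne]].
  by rewrite mcoeffZ; have [_ _ _ ->] := hr m; rewrite // mcoeffX eqxx mulr1.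
rewrite mcoeffZ [(r m')@_m]memN_msupp_eq0 ?mulr0 //; have [_ _ h _] := hr m'.
apply/negP => /h [e|lt]; first by rewrite e eqxx in ne.
by have := drl_lt_trans lt (max _ hm' ne); rewrite drl_lt_irr.
Qed.

(** A leading monomial dividing a staircase monomial is itself staircase, so it survives reduction;
    yet an element of the ideal reduces to a staircase polynomial in the ideal, which is 0. *)
Lemma stair_normal_form n (p : {mpoly int[n]}) :
  supported (@stair n) p -> is_normal_form p.
Proof.
move=> hp f m m' hf hlead hm' hle.
have sm : stair m by move=> i; apply: leq_ltn_trans (hle i) (hp _ hm' i).
have [r [rI rs rlead]] := reduce_flag_ideal f.
have r0 : r = 0.
  apply: stair_flag_ideal_eq0 => //.
  by rewrite -[r](subKr f) rpredB.
have := rlead m hlead sm; rewrite r0 mcoeff0 => /esym/eqP.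
by rewrite mcoeff_eq0 (proj1 hlead).
Qed.

(** The leading monomial of a nonzero [p - q] would occur in [p] or in [q]. *)
Lemma normal_form_unique n (p q : {mpoly int[n]}) :
  is_normal_form p -> is_normal_form q -> p - q \in @flag_ideal n -> p = q.
Proof.
move=> np nq hI; apply/eqP; rewrite -subr_eq0; apply/negPn/negP => /drl_lead_ex [m lead].
have /msuppB_le := proj1 lead; rewrite mem_cat => /orP [hm|hm].
  exact: (np _ _ _ hI lead hm).
exact: (nq _ _ _ hI lead hm).
Qed.

Lemma flag_class_eq n (p q : {mpoly int[n]}) :
  (flag_class p = flag_class q) <-> (p - q \in @flag_ideal n).
Proof. by rewrite Quotient.idealrBE; split => [h|/eqP //]; apply/eqP. Qed.

Lemma normal_formE n (p : {mpoly int[n]}) h :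
  supported (@stair n) p -> flag_class p = h -> normal_form h = p.
Proof.
move=> /stair_normal_form np hp; apply: xget_unique; first by split.
move=> q [nq hq]; apply: normal_form_unique => //; apply/flag_class_eq.
by rewrite hp.
Qed.

(** The functionals agree on [f] and its staircase remainder, to which the exact expansion
    applies. *)
Lemma schubert_expansion_mod n (f : {mpoly int[n]}) :
  f - \sum_w schubert_coef w f *: schubert w \in @flag_ideal n.
Proof.
have [r [rI rs _]] := reduce_flag_ideal f.
suff -> : \sum_w schubert_coef w f *: schubert w = r by [].
rewrite [RHS](schubert_expansion rs); apply: eq_bigr => w _.
by rewrite -{1}(subrK r f) schubert_coefD schubert_coef_flag_ideal ?add0r.
Qed.

(** * The inclusion of Sigma_n in Sigma_(n+k) *)

Section Embedding.
Variables n k : nat.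

Definition embed (f : {mpoly int[n]}) : {mpoly int[n + k]} :=
  f \mPo [tuple 'X_(lshift k i) | i < n].

Lemma embedD f g : embed (f + g) = embed f + embed g.
Proof. exact: comp_mpolyD. Qed.

Lemma embedB f g : embed (f - g) = embed f - embed g.
Proof. exact: comp_mpolyB. Qed.

Lemma embedZ c f : embed (c *: f) = c *: embed f.
Proof. exact: comp_mpolyZ. Qed.

Lemma embedM f g : embed (f * g) = embed f * embed g.
Proof. exact: (rmorphM (comp_mpoly _)). Qed.

Lemma embed_sum (I : Type) (r : seq I) (Q : pred I) F :
  embed (\sum_(i <- r | Q i) F i) = \sum_(i <- r | Q i) embed (F i).
Proof. exact: raddf_sum. Qed.

Lemma embedXi i : embed 'X_i = 'X_(lshift k i).
Proof. by rewrite /embed comp_mpolyXU -tnth_nth tnth_mktuple. Qed.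

Lemma eps_embed f : eps (embed f) = eps f.
Proof.
rewrite /eps /embed comp_mpoly_meval; apply: meval_eq => i.
by rewrite tnth_mktuple mevalXU.
Qed.

Definition widen_mnm (m : 'X_{1..n}) : 'X_{1..n + k} :=
  [multinom if split i is inl j then m j else 0%N | i < n + k].

Lemma widen_mnm_lshift m i : widen_mnm m (lshift k i) = m i.
Proof. by rewrite mnmE (unsplitK (inl i)). Qed.

Lemma widen_mnm_rshift m i : widen_mnm m (rshift n i) = 0%N.
Proof. by rewrite mnmE (unsplitK (inr i)). Qed.

Lemma embedX m : embed 'X_[m] = 'X_[widen_mnm m].
Proof.
rewrite /embed comp_mpolyX [RHS]mpolyXE_id big_split_ord /=.
rewrite [X in _ = _ * X]big1 ?mulr1 => [|i _]; last by rewrite widen_mnm_rshift.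
by apply: eq_bigr => i _; rewrite tnth_mktuple widen_mnm_lshift.
Qed.

Lemma embed_supported (P : 'X_{1..n} -> Prop) (Q : 'X_{1..n + k} -> Prop) f :
  supported P f -> (forall m, P m -> Q (widen_mnm m)) -> supported Q (embed f).
Proof.
move=> hf PQ; rewrite [f]mpolyE embed_sum; apply: supported_sum_seq => m hm.
by rewrite embedZ embedX; apply: supportedZ; apply: supportedX; apply: PQ; apply: hf.
Qed.

Lemma msym_embed (a b : 'I_n) f :
  msym (tperm (lshift k a) (lshift k b)) (embed f) = embed (msym (tperm a b) f).
Proof.
rewrite [f]mpolyE embed_sum !raddf_sum embed_sum; apply: eq_bigr => m _ /=.
rewrite embedZ !msymZ embedZ; congr (_ *: _).
rewrite mpolyXE_id /embed !rmorph_prod; apply: eq_bigr => i _.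
rewrite /= !rmorphXn /= msymXi -!/(embed _) !embedXi msymXi.
by rewrite -inj_tperm //; apply: lshift_inj.
Qed.

Lemma divdiff_embed (a b : 'I_n) f : a != b ->
  divdiff (lshift k a) (lshift k b) (embed f) = embed (divdiff a b f).
Proof.
move=> ab; apply: divdiff_uniq; first by rewrite (inj_eq (@lshift_inj _ _)).
by rewrite msym_embed -!embedXi -!embedB -embedM divdiffP.
Qed.

Lemma msym_tperm_id N (a b : 'I_N) f :
  supported (fun m => m a = m b) f -> msym (tperm a b) f = f.
Proof.
move=> hf; rewrite {2}[f]mpolyE {1}[f]mpolyE raddf_sum big_seq [RHS]big_seq.
apply: eq_bigr => m /hf h; rewrite /= msymZ msymX tpermV; congr (_ *: 'X_[_]).
by apply/mnmP => i; rewrite mnmE; case: tpermP => [->|->|].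
Qed.

(** The last original variable is included, as its staircase exponent is below 1; this covers the
    swap across the boundary between old and new variables. *)
Lemma widen_mnm_stair_tail m (i : 'I_(n + k)) :
  stair m -> (n <= i.+1)%N -> widen_mnm m i = 0%N.
Proof.
move=> hm; case: (split_ordP i) => j ->; last by rewrite widen_mnm_rshift.
by rewrite widen_mnm_lshift /= => hj; have := hm j; lia.
Qed.

Lemma divdiff_embed_tail (a b : 'I_(n + k)) f : b = a.+1 :> nat -> (n <= b)%N ->
  supported (@stair n) f -> divdiff a b (embed f) = 0.
Proof.
move=> hab hb hf; apply: divdiff_eq0; first exact: adj_neq.
apply: msym_tperm_id; apply: (embed_supported hf) => m hm.
by rewrite !widen_mnm_stair_tail //; lia.
Qed.

Lemma embed_stair f : supported (@stair n) f -> supported (@stair (n + k)) (embed f).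
Proof.
move=> hf; apply: (embed_supported hf) => m hm i.
case: (split_ordP i) => j ->; rewrite ?widen_mnm_lshift ?widen_mnm_rshift /=.
  by have := hm j; lia.
by have := ltn_ord j; lia.
Qed.

Lemma stable_perm_lshift (s : 'S_n) i : stable_perm k s (lshift k i) = lshift k (s i).
Proof. by rewrite permE /stable_fun (unsplitK (inl i)). Qed.

Lemma stable_perm_rshift (s : 'S_n) i : stable_perm k s (rshift n i) = rshift n i.
Proof. by rewrite permE /stable_fun (unsplitK (inr i)). Qed.

Lemma stable_perm_inj : injective (stable_perm k : 'S_n -> _).
Proof.
move=> s t h; apply/permP => i; apply: (@lshift_inj n k).
by rewrite -!stable_perm_lshift h.
Qed.

Lemma stable_perm1 : stable_perm k (1%g : 'S_n) = 1%g.
Proof.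
apply/permP => i; case: (split_ordP i) => j ->;
by rewrite ?stable_perm_lshift ?stable_perm_rshift !perm1.
Qed.

Lemma stable_permM_tperm (a b : 'I_n) (w : 'S_n) :
  stable_perm k (tperm a b * w)%g = (tperm (lshift k a) (lshift k b) * stable_perm k w)%g.
Proof.
apply/permP => i; rewrite permM; case: (split_ordP i) => j ->.
  by rewrite -inj_tperm ?stable_perm_lshift ?permM //; apply: lshift_inj.
by rewrite tpermD ?stable_perm_rshift // eq_lrshift.
Qed.

Lemma stable_perm_tail_ascent (u : 'S_n) (a b : 'I_(n + k)) :
  b = a.+1 :> nat -> (n <= b)%N -> (stable_perm k u a < stable_perm k u b)%N.
Proof.
move=> hab; case: (split_ordP b) => j eb; subst b => hb.
  by have := ltn_ord j; rewrite /= in hb; lia.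
rewrite stable_perm_rshift; case: (split_ordP a) hab => i -> hab.
  by rewrite stable_perm_lshift /=; have := ltn_ord (u i); lia.
by rewrite stable_perm_rshift hab.
Qed.

(** As in [schubert_coef_schubert], with one new case: a swap reaching past the old positions kills
    embedded staircase polynomials, while stable permutations ascend there. *)
Lemma schubert_coef_embed_schubert (t : 'S_(n + k)) (u : 'S_n) :
  schubert_coef t (embed (schubert u)) = (t == stable_perm k u)%:R.
Proof.
pose P (t : 'S_(n + k)) (h : {mpoly int[n + k]} -> int) :=
  h 0 = 0 /\ forall u, h (embed (schubert u)) = (t == stable_perm k u)%:R.
suff [] : P t (schubert_coef t) by [].
elim/schubert_coef_ind: t / (schubert_coef t) => [|w a b h hab hw [h0 IH]].
  split=> [|v]; first by rewrite /eps meval0.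
  by rewrite eps_embed eps_schubert -stable_perm1 (inj_eq stable_perm_inj) eq_sym.
have ab := adj_neq hab; split=> [|v] /=; first by rewrite divdiff0.
case: (ltnP b n) => hb; last first.
  rewrite divdiff_embed_tail // ?h0; last exact: schubert_stair.
  by case: eqP => // e; move: hw; rewrite e ltnNge ltnW // stable_perm_tail_ascent.
have ha : (a < n)%N by lia.
have ea : a = lshift k (Ordinal ha) by apply: val_inj.
have eb : b = lshift k (Ordinal hb) by apply: val_inj.
move: (Ordinal ha) (Ordinal hb) ea eb => a' b' ea eb; subst a b.
rewrite (inj_eq (@lshift_inj _ _)) in ab; rewrite divdiff_embed //.
case: (ltngtP (v a') (v b')) => [lt|gt|/val_inj /perm_inj e].
- rewrite divdiff_schubert_ascent // /embed raddf0 h0.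
  case: eqP => [e|//]; move: hw; rewrite e !stable_perm_lshift /=.
  by rewrite ltnNge ltnW.
- rewrite divdiff_schubert_descent // IH stable_permM_tperm.
  congr (nat_of_bool _)%:R.
  by apply/eqP/eqP => [/mulgI|->].
- by rewrite e eqxx in ab.
Qed.

(** Stability of Schubert polynomials, read off from the expansion of the embedded polynomial. *)
Lemma schubert_stable (u : 'S_n) :
  schubert (stable_perm k u) = embed (schubert u).
Proof.
rewrite [RHS]schubert_expansion; last by apply: embed_stair; apply: schubert_stair.
rewrite (bigD1 (stable_perm k u)) //= schubert_coef_embed_schubert eqxx scale1r.
rewrite big1 ?addr0 // => t /negbTE ht.
by rewrite schubert_coef_embed_schubert ht scale0r.
Qed.

(** The image of the ideal need not lie in the larger ideal. Descents of a stable permutation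
    involve only old positions, however, and those divided differences preserve the original
    ideal. *)
Lemma schubert_coef_embed_flag_ideal (w : 'S_n) f : f \in @flag_ideal n ->
  schubert_coef (stable_perm k w) (embed f) = 0.
Proof.
pose P (t : 'S_(n + k)) (h : {mpoly int[n + k]} -> int) :=
  forall w f, t = stable_perm k w -> f \in @flag_ideal n -> h (embed f) = 0.
suff H t : P t (schubert_coef t) by apply: (H _ w).
elim/schubert_coef_ind: t / (schubert_coef t) => [v g _ hg|t a b h hab ht IH v g e hg].
  by rewrite eps_embed eps_flag_ideal.
case: (ltnP b n) => hb; last first.
  by move: ht; rewrite e ltnNge ltnW // stable_perm_tail_ascent.
have ha : (a < n)%N by lia.
have ea : a = lshift k (Ordinal ha) by apply: val_inj.
have eb : b = lshift k (Ordinal hb) by apply: val_inj.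
have ab := adj_neq hab.
move: (Ordinal ha) (Ordinal hb) ea eb => a' b' ea eb; subst a b.
rewrite (inj_eq (@lshift_inj _ _)) in ab; rewrite /= divdiff_embed //.
apply: (IH (tperm a' b' * v)%g); first by rewrite e stable_permM_tperm.
exact: divdiff_flag_ideal.
Qed.

Lemma schubert_coef_embed (w : 'S_n) f :
  schubert_coef (stable_perm k w) (embed f) = schubert_coef w f.
Proof.
have h := schubert_expansion_mod f; set g := \sum_w _ in h.
rewrite -{1}[f](subrK g) embedD schubert_coefD schubert_coef_embed_flag_ideal // add0r.
rewrite /g embed_sum schubert_coef_sum (bigD1 w) //= big1 => [|t tw].
  by rewrite embedZ schubert_coefZ schubert_coef_embed_schubert eqxx mulr1 addr0.
rewrite embedZ schubert_coefZ schubert_coef_embed_schubert (inj_eq stable_perm_inj).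
by rewrite eq_sym (negbTE tw) mulr0.
Qed.

End Embedding.

Lemma structure_coefE n (u v w : 'S_n) :
  structure_coef u v w = schubert_coef w (schubert u * schubert v).
Proof.
apply: xget_unique => [|z [k [c [h ->]]]].
  (* Doubling suffices: exponents of the product are below [2 * (n - i)], hence within the staircase
     bound [n + n - i]. *)
  exists n, (fun t => schubert_coef t (embed n (schubert u * schubert v))).
  rewrite !schubert_stable -embedM schubert_coef_embed; split => //.
  apply: schubert_expansion.
  apply: (embed_supported (P := fun m => forall i : 'I_n, (m i < 2 * (n - i))%N)).
    apply: (supportedM (@schubert_stair n u) (@schubert_stair n v)) => m m' hm hm' i.
    by rewrite mnmDE; have := hm i; have := hm' i; lia.
  move=> m hm i; case: (split_ordP i) => j ->.
    by rewrite widen_mnm_lshift /=; have := hm j; have := ltn_ord j; lia.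
  by rewrite widen_mnm_rshift /=; have := ltn_ord j; lia.
(* Any other expansion, in whatever larger group, has its coefficient extracted by the same
   functional. *)
rewrite -(schubert_coef_embed k) embedM -!schubert_stable h schubert_coef_sum.
rewrite (bigD1 (stable_perm k w)) //= big1 => [|t tw].
  by rewrite schubert_coefZ schubert_coef_schubert eqxx mulr1 addr0.
by rewrite schubert_coefZ schubert_coef_schubert eq_sym (negbTE tw) mulr0.
Qed.

(** * Duality *)

Lemma eq_schubert_coef n (phi psi : {mpoly int[n]} -> int) :
  linear_for *%R phi -> linear_for *%R psi ->
  (forall f, f \in @flag_ideal n -> phi f = 0) ->
  (forall f, f \in @flag_ideal n -> psi f = 0) ->
  (forall w, phi (schubert w) = psi (schubert w)) -> phi =1 psi.
Proof.
move=> lphi lpsi Iphi Ipsi h f.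
suff E (chi : {mpoly int[n]} -> int) : linear_for *%R chi ->
    (forall f, f \in @flag_ideal n -> chi f = 0) ->
    chi f = \sum_w schubert_coef w f * chi (schubert w).
  by rewrite (E phi) // (E psi) //; apply: eq_bigr => w _; rewrite h.
move=> lchi Ichi; have c0 : chi 0 = 0 by apply: Ichi; rewrite rpred0.
have cD g1 g2 : chi (g1 + g2) = chi g1 + chi g2.
  by rewrite -[g1 in LHS]scale1r lchi mul1r.
have cZ c g : chi (c *: g) = c * chi g by rewrite -[c *: g]addr0 lchi c0 addr0.
rewrite -{1}[f](subrK (\sum_w schubert_coef w f *: schubert w)) cD.
rewrite (Ichi _ (schubert_expansion_mod f)) add0r (big_morph chi cD c0).
by apply: eq_bigr => w _; rewrite cZ.
Qed.

(** Independence of the chosen descent: both functionals are linear, vanish on the ideal and agree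
    on Schubert polynomials. *)
Lemma schubert_coef_divdiff n (w : 'S_n) (a b : 'I_n) f :
  b = a.+1 :> nat -> (w b < w a)%N ->
  schubert_coef (tperm a b * w)%g (divdiff a b f) = schubert_coef w f.
Proof.
move=> hab hw; have ab := adj_neq hab; move: f; apply: eq_schubert_coef.
- by move=> c g h; rewrite divdiffD // divdiffZ // schubert_coef_linear.
- by move=> c g h; rewrite schubert_coef_linear.
- by move=> g hg; rewrite schubert_coef_flag_ideal // divdiff_flag_ideal.
- exact: schubert_coef_flag_ideal.
move=> u; rewrite schubert_coef_schubert.
case: (ltngtP (u a) (u b)) => [lt|gt|/val_inj /perm_inj e].
- rewrite divdiff_schubert_ascent // schubert_coef0.
  by case: eqP => [e|//]; move: hw; rewrite e ltnNge ltnW.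
- rewrite divdiff_schubert_descent // schubert_coef_schubert.
  congr (nat_of_bool _)%:R.
  by apply/eqP/eqP => [/mulgI|->].
- by rewrite e eqxx in ab.
Qed.

(** Integration over the flag manifold: the coefficient of the class of a point. *)
Definition top_coef n : {mpoly int[n]} -> int := schubert_coef (longest n).

(** The longest element descends everywhere, so one more divided difference may be applied inside;
    by invariance both sides become that of the product of the two divided differences. *)
Lemma top_coef_divdiff n (a b : 'I_n) f g : b = a.+1 :> nat ->
  top_coef (divdiff a b f * g) = top_coef (f * divdiff a b g).
Proof.
move=> hab; have ab := adj_neq hab.
have hl : (longest n b < longest n a)%N.
  by rewrite !longestE /=; have := ltn_ord b; lia.
rewrite /top_coef -!(schubert_coef_divdiff _ hab hl).
rewrite (mulrC (divdiff a b f) g) (divdiffM_sym ab g (msym_divdiff ab f)).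
by rewrite (divdiffM_sym ab f (msym_divdiff ab g)) (mulrC (divdiff a b g)).
Qed.

Lemma schubert_duality n (u w : 'S_n) :
  top_coef (schubert u * schubert (w0mul w)) = (u == w)%:R.
Proof.
elim/perm_ascent_ind: u w => [|u a b hab hu IH] w.
  have [<-|hw] := eqVneq (longest n) w.
    by rewrite /w0mul longest_mul schubert1 mulr1 /top_coef schubert_coef_schubert eqxx.
  (* For the longest [u] and any other [w], the degree of the product exceeds the top degree. *)
  apply: (@schubert_coef_pos_degree _ _
     (perm_length (longest n) + perm_length (w0mul w))%N).
    rewrite -[X in (X < _)%N]addn0 ltn_add2l lt0n; apply: contraNneq hw.
    by move=> /perm_length_eq0 h; rewrite -[w]w0mulK h /w0mul mul1g.
  apply: (supportedM (@schubert_homog n _) (@schubert_homog n _)) => m m' <- <-.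
  exact: mdegD.
rewrite (schubert_ascent hab hu) top_coef_divdiff //.
have ab := adj_neq hab.
case: (ltngtP (w a) (w b)) => [lt|gt|/val_inj /perm_inj e].
- rewrite divdiff_schubert_descent // ?w0mul_lt // -w0mul_mul IH.
  by congr (nat_of_bool _)%:R; apply/eqP/eqP => [/mulgI|->].
- rewrite divdiff_schubert_ascent // ?w0mul_lt // mulr0 /top_coef schubert_coef0.
  by case: eqP => [e|//]; move: hu; rewrite e ltnNge ltnW.
- by rewrite e eqxx in ab.
Qed.

Lemma schubert_coefE n (w : 'S_n) f :
  schubert_coef w f = top_coef (f * schubert (w0mul w)).
Proof.
move: f; apply: eq_schubert_coef.
- by move=> c g h; rewrite schubert_coef_linear.
- by move=> c g h; rewrite mulrDl -scalerAl /top_coef schubert_coef_linear.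
- exact: schubert_coef_flag_ideal.
- move=> g hg; rewrite mulrC /top_coef schubert_coef_flag_ideal //.
  exact: idealMr.
by move=> u; rewrite schubert_coef_schubert schubert_duality eq_sym.
Qed.

Theorem theorem1p1 (n : nat) (hn : (1 <= n)%N) (u w : 'S_n)
    (huw : bruhat_le u w) :
  skew_schubert w u = \sum_(v : 'S_n) structure_coef u v w *: schubert (w0mul v).
Proof.
apply: normal_formE.
  by apply: supported_sum => v _; apply: supportedZ; apply: schubert_stair.
have -> : schubert_class u * schubert_class (w0mul w) =
    flag_class (schubert u * schubert (w0mul w)).
  by rewrite /schubert_class /flag_class rmorphM.
apply/flag_class_eq; rewrite -opprB rpredN.
(* After reindexing by [v] to [w0mul v], both coefficients are [top_coef] of the product of the
   Schubert polynomials of [u], [v] and [w0mul w]. *)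
have -> : \sum_v structure_coef u v w *: schubert (w0mul v) =
    \sum_v schubert_coef v (schubert u * schubert (w0mul w)) *: schubert v.
  rewrite [RHS](reindex_inj (inv_inj (@w0mulK n))); apply: eq_bigr => v _.
  by rewrite structure_coefE !schubert_coefE w0mulK mulrAC.
exact: schubert_expansion_mod.
Qed.
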